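(* Let $S=(S,\le)$ be a compact partially ordered Polish space with a least element $a$ and a greatest element $b$. Let $\mathbb T$ be either $\mathbb R_+$ or $\mathbb Z_+$ and let $(P_t)_{t\in\mathbb T}$ be a transition probability function on $S$. If $(P_t)_{t\in\mathbb T}$ is increasing and there exists a positive $u\in\mathbb T$ such that $P_u$ satisfies the monotone mixing condition (with $\epsilon>0$ denoting the constant in that condition), then $(P_t)_{t\in\mathbb T}$ is globally stable on $\mathcal P(S)$ under $\beta$, and convergence to the unique fixed point $\phi^*$ is exponential: $$\beta(\phi P_t,\phi^* )\le Ce^{-\alpha t}\quad\text{for all }\phi\in\mathcal P(S)\text{ and }t\in\mathbb T,$$ where $C:=2/(1-\epsilon)$ and $\alpha:=\ln(1/(1-\epsilon))/u$. Moreover, when $\mathbb T=\mathbb Z_+$, each $P$-Markov process $(X_t)_{t\in\mathbb Z_+}$ (where $P:=P_1$) is monotone ergodic: $$\mathbb P\Big\{\lim_{n\to\infty}\frac1n\sum_{t=0}^{n-1}h(X_t)=\phi^*(h)\Big\}=1\quad\text{for all }h\in ibS.$$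
   Context: A partially ordered Polish space is a separable, completely metrizable topological space with a closed partial order $\le$ (that is, $x_i\le y_i$ for all $i$, $x_i\to x$, $y_i\to y$ imply $x\le y$). $\mathcal B$ is the Borel $\sigma$-algebra of $S$, $\mathcal P(S)$ is the set of probability measures on $(S,\mathcal B)$, $ibS$ is the set of bounded Borel measurable increasing functions $h:S\to\mathbb R$ (increasing means $x\le y$ implies $h(x)\le h(y)$), and $\phi(h)=\int h\,d\phi$. Write $\phi\preceq_{\mathrm{sd}}\psi$ if $\phi(h)\le\psi(h)$ for all $h\in ibS$. The Bhattacharya metric on $\mathcal P(S)$ is $\beta(\phi,\psi)=\sup\{|\phi(h)-\psi(h)|:h\in ibS,\ |h|\le1\}$. A stochastic kernel $P$ on $S$ is a map $P:S\times\mathcal B\to[0,1]$ with $P(x,\cdot)\in\mathcal P(S)$ for each $x\in S$ and $x\mapsto P(x,B)$ measurable for each $B\in\mathcal B$. It acts on distributions by $(\phi P)(B)=\int P(x,B)\,\phi(dx)$. It is increasing if $x\le x'$ implies $P(x,\cdot)\preceq_{\mathrm{sd}}P(x',\cdot)$. A transition probability function is a family of stochastic kernels $(P_t)_{t\in\mathbb T}$ with $P_0(x,\cdot)=\delta_x$ for all $x\in S$ and $P_{s+t}(x,B)=\int P_t(y,B)\,P_s(x,dy)$ for all $s,t\in\mathbb T$, $x\in S$, $B\in\mathcal B$; it is increasing if $P_t$ is increasing for every $t\in\mathbb T$. A stochastic kernel $P$ on $S$ satisfies the monotone mixing condition if there exist an $\hat x\in S$ and an $\epsilon>0$ such that $P(a,\{y\in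 S:\hat x\le y\})\ge\epsilon$ and $P(b,\{y\in S:y\le\hat x\})\ge\epsilon$. $(P_t)_{t\in\mathbb T}$ is globally stable on $\mathcal P(S)$ under $\beta$ if there is a unique $\phi^*\in\mathcal P(S)$ with $\phi^*P_t=\phi^*$ for all $t\in\mathbb T$, and $\beta(\phi P_t,\phi^* )\to0$ as $t\to\infty$ for all $\phi\in\mathcal P(S)$. An $S$-valued stochastic process $(X_t)_{t\in\mathbb Z_+}$ on a probability space $(\Omega,\mathcal F,\mathbb P)$ is $P$-Markov if $\mathbb P\{X_{t+1}\in B\mid\mathcal F_t\}=P(X_t,B)$ almost surely for all $t\in\mathbb Z_+$ and $B\in\mathcal B$, where $(\mathcal F_t)$ is its natural filtration. *)

(* Defs.v *)
From HB Require Import structures.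
From mathcomp Require Import all_boot all_order all_algebra.
From mathcomp Require Import all_classical all_reals all_analysis.
From mathcomp Require Import measurable_realfun.

Set Implicit Arguments.
Unset Strict Implicit.
Unset Printing Implicit Defensive.

Import Order.TTheory GRing.Theory Num.Theory.
Import numFieldNormedType.Exports.

Local Open Scope classical_set_scope.
Local Open Scope ring_scope.

Notation borel S := (g_sigma_algebraType (@open S)).

Definition separable_space (T : topologicalType) : Prop :=
  exists2 D : set T, countable D & dense D.

Definition completely_metrizable (R : realType) (T : topologicalType) : Prop :=
  exists dist : T -> T -> R,
    [/\ [/\ (forall x y, 0 <= dist x y),
            (forall x y, dist x y = 0 <-> x = y),
            (forall x y, dist x y = dist y x) &
            (forall x y z, dist x z <= dist x y + dist y z)],
        (forall x, nbhs x = filter_from [set e : R | 0 < e]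
                              (fun e => [set y | dist x y < e])) &
        (forall u : nat -> T,
          (forall e : R, 0 < e -> exists N : nat, forall m n : nat,
             (N <= m)%N -> (N <= n)%N -> dist (u m) (u n) < e) ->
          exists l : T, u @ \oo --> l)].

Definition closed_order d (S : POrderedPointedTopological.type d) : Prop :=
  forall (x_ y_ : nat -> S) (x y : S),
    (forall i, (x_ i <= y_ i)%O) ->
    x_ @ \oo --> x -> y_ @ \oo --> y -> (x <= y)%O.

Definition partially_ordered_polish (R : realType) d
    (S : POrderedPointedTopological.type d) : Prop :=
  [/\ separable_space S, completely_metrizable R S & closed_order S].

Section kernel_action.
Local Open Scope ereal_scope.
Context d (T : measurableType d) (R : realType).
Variables (phi : probability T R) (k : R.-pker T ~> T).

Definition kernel_action (B : set T) : \bar R := \int[phi]_x k x B.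

Let action0 : kernel_action set0 = 0.
Proof.
by rewrite /kernel_action (eq_integral (cst 0)) ?integral0// => y _; rewrite measure0.
Qed.

Let action_ge0 B : 0 <= kernel_action B.
Proof. exact: integral_ge0. Qed.

Let action_sigma_additive : semi_sigma_additive kernel_action.
Proof.
move=> F mF tF mUF; rewrite [X in _ --> X](_ : _ =
  \int[phi]_y (\sum_(n <oo) k y (F n))); last first.
  apply: eq_integral => y _.
  by apply/esym/cvg_lim => //; exact: measure_semi_sigma_additive.
apply/cvg_closeP; split.
  by apply: is_cvg_nneseries => n _ _; exact: integral_ge0.
rewrite closeE// integral_nneseries// => n.
exact: measurable_kernel.
Qed.

HB.instance Definition _ := isMeasure.Build _ _ _ kernel_action
  action0 action_ge0 action_sigma_additive.

Let action_setT : kernel_action [set: T] = 1.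
Proof.
rewrite /kernel_action (eq_integral (cst 1)) => [|y _].
  rewrite integral_cst// mul1e; exact: probability_setT.
by rewrite prob_kernel.
Qed.

HB.instance Definition _ :=
  Measure_isProbability.Build _ _ _ kernel_action action_setT.

Definition act : probability T R := kernel_action.

End kernel_action.

Section monotone.
Context d (S : POrderedPointedTopological.type d) (R : realType).
Implicit Types (phi psi : probability (borel S) R)
  (k : R.-pker (borel S) ~> (borel S)).

Definition ib (h : S -> R) : Prop :=
  [/\ measurable_fun [set: borel S] h,
      (exists M : R, forall x, `|h x| <= M) &
      (forall x y : S, (x <= y)%O -> h x <= h y)].

(* [k x] is only typed as a measure in the library, even for a probability
   kernel [k]. *)
Definition sd_le (phi psi : {measure set (borel S) -> \bar R}) : Prop :=
  forall h, ib h -> \int[phi]_x h x <= \int[psi]_x h x.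

(* The set is nonempty and bounded by 2, so the real-valued [sup] is the
   actual supremum. *)
Definition bhattacharya phi psi : R :=
  sup [set r | exists h : S -> R,
    [/\ ib h, (forall x, `|h x| <= 1) &
        r = `|\int[phi]_x h x - \int[psi]_x h x|]].

Definition increasing_kernel k : Prop :=
  forall x x' : S, (x <= x')%O -> sd_le (k x) (k x').

Definition monotone_mixing (a b : S) k (eps : R) : Prop :=
  0 < eps /\ exists xhat : S,
    (eps%:E <= k a [set y : S | (xhat <= y)%O])%E /\
    (eps%:E <= k b [set y : S | (y <= xhat)%O])%E.

End monotone.

Definition nonneg_reals {R : realType} : set R := [set t | 0 <= t].
Definition nonneg_integers {R : realType} : set R := range (fun n : nat => n%:R).

(* The index set is represented as a subset [Time] of [R]; the kernels [P t]
   for [t] outside [Time] are never constrained nor used. *)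
Section transition.
Context d (S : POrderedPointedTopological.type d) (R : realType).
Variables (Time : set R) (P : R -> R.-pker (borel S) ~> (borel S)).

Definition transition_function : Prop :=
  (forall (x : S) (B : set (borel S)), measurable B -> P 0 x B = \d_(x : borel S) B) /\
  (forall (s t : R) (x : S) (B : set (borel S)),
     Time s -> Time t -> measurable B ->
     P (s + t) x B = (\int[P s x]_y P t y B)%E).

Definition increasing_transition : Prop :=
  forall t, Time t -> increasing_kernel (P t).

(* Measures are compared on measurable sets only: a [probability] is a
   function on all sets, with arbitrary values on the nonmeasurable ones. *)
Definition stationary (phi : probability (borel S) R) : Prop :=
  forall t, Time t ->
  forall B : set (borel S), measurable B -> act phi (P t) B = phi B.

Definition globally_stable : Prop :=
  exists phistar : probability (borel S) R,
    [/\ stationary phistar,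
        (forall psi : probability (borel S) R, stationary psi ->
           forall B : set (borel S), measurable B -> psi B = phistar B) &
        (forall phi : probability (borel S) R,
           bhattacharya (act phi (P t)) phistar
             @[t --> within Time (pinfty_nbhs R)] --> 0)].

End transition.

Section markov.
Context d (S : POrderedPointedTopological.type d) (R : realType).
Context dO (Omega : measurableType dO) (Pr : probability Omega R).

Definition natural_filtration (X : nat -> {RV Pr >-> borel S}) (t : nat) :
    set (set Omega) :=
  <<s \bigcup_(i in [set i : nat | (i <= t)%N])
        g_sigma_algebra_preimage (X i) >>.

(* [g] is a version of the conditional probability of [A] given the
   sigma-algebra [G]. *)
Definition cond_prob (G : set (set Omega)) (A : set Omega)
    (g : Omega -> \bar R) : Prop :=
  [/\ Pr.-integrable [set: Omega] g,
      (forall Y : set (\bar R), measurable Y -> G (g @^-1` Y)) &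
      (forall F, G F -> (\int[Pr]_(w in F) g w)%E = Pr (A `&` F))].

Definition markov_process (k : R.-pker (borel S) ~> (borel S))
    (X : nat -> {RV Pr >-> borel S}) : Prop :=
  forall (t : nat) (B : set (borel S)), measurable B ->
    exists2 g : Omega -> \bar R,
      cond_prob (natural_filtration X t) (X t.+1 @^-1` B) g &
      {ae Pr, forall w, g w = k (X t w) B}.

Definition monotone_ergodic (phistar : probability (borel S) R)
    (X : nat -> {RV Pr >-> borel S}) : Prop :=
  forall h : S -> R, ib h ->
    Pr [set w | n%:R^-1 * (\sum_(0 <= t < n) h (X t w)) @[n --> \oo]
                  --> \int[phistar]_x h x] = 1%E.

End markov.

(* Main.v *)
Require Import Defs.
From HB Require Import structures.
From mathcomp Require Import all_boot all_order all_algebra.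
From mathcomp Require Import all_classical all_reals all_analysis.
From mathcomp Require Import measurable_realfun.
From mathcomp Require Import zify ring lra.

Set Implicit Arguments.
Unset Strict Implicit.
Unset Printing Implicit Defensive.

Import Order.TTheory GRing.Theory Num.Theory.
Import numFieldNormedType.Exports.

Local Open Scope classical_set_scope.
Local Open Scope ring_scope.

(** Let [h] be increasing.  Since [a <= x <= b] for all [x], the values of [h],
    and its integral against any probability measure, lie between [h a] and
    [h b]; so two probability measures differ on [h] by at most the oscillation
    [h b - h a].  An increasing kernel maps increasing functions to increasing
    functions, and the mixing condition makes [P u] contract oscillations by the
    factor [1 - eps]: from [b] the chain falls below the mixing point [z] with
    probability at least [eps], which costs [eps * (h b - h z)], from [a] it
    rises above [z] with probability at least [eps], which gains
    [eps * (h z - h a)], and the two add up ([kint_mixing]).  Iterating along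
    the multiples of [u] below [t] gives the exponential bound
    ([osc_geometric], [bhattacharya_exponential]).

    Uniqueness of the stationary law needs that the Borel up-sets determine a
    probability measure.  In a compact space with closed order they do: finite
    intersections of complements of closed up-sets and closed down-sets taken
    from a countable family form a base of the topology
    ([open_sub_updiff_sigma]).

    For existence, the laws [delta_a P_(n u)] form a Cauchy sequence uniformly
    over Borel up-sets, and such a sequence has a limit
    ([upset_cauchy_limit]).  The limit is built on the semiring of differences
    of Borel up-sets; it is countably additive there because each law of the
    sequence is regular, the regularity survives the uniform limit, and compact
    sets admit finite subcovers.  Since the convergence holds on all up-sets,
    and not only on continuous functions, it passes through [P t], which need
    not be Feller; hence the limit is stationary ([stationary_exists]).

    For the law of large numbers, the Markov property turns the exponential
    bound into exponential decay of the correlations of the centered variables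
    [h (X t)] ([correlation_decay]).  Their partial sums then have second
    moments of order [n], the averages along the squares are almost surely
    square summable, and boundedness controls the averages between consecutive
    squares ([markov_average_cvg0]). *)

(** * Closed bases and closed order *)

(** A base of neighbourhoods made of closed sets: with a countable index it is all
    that is used of the metric, apart from turning the sequential closedness of
    the order into a statement about neighbourhoods. *)
Definition closed_basis (T : topologicalType) (I : Type) (B : I -> set T) :=
  (forall i, closed (B i)) /\
  (forall (x : T) N, nbhs x N -> exists2 i, nbhs x (B i) & B i `<=` N).

(** Closed balls of radius [1 / (k + 1)] around the points of a countable dense
    set, which an injection into [nat] enumerates. *)
Lemma polish_closed_basis (R : realType) (T : topologicalType) :
  separable_space T -> completely_metrizable R T ->
  exists B : nat * nat -> set T, closed_basis B.
Proof.
move=> [D /countable_injP[g ginj] denseD] [dist [[d0 d_eq0 dC dD] nbhsE _]].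
pose c n := [set x | D x /\ g x = n].
pose B (i : nat * nat) := [set y | exists2 x, c i.1 x & dist x y <= i.2.+1%:R^-1].
have BE n k x : c n x -> B (n, k) = [set y | dist x y <= k.+1%:R^-1].
  move=> [Dx gx]; apply/seteqP; split=> [y [z [Dz gz] /=]|y xy]; last by exists x.
  by rewrite (ginj z x) ?inE// gz gx.
have cball x r : closed [set y | dist x y <= r].
  move=> y ycl /=; rewrite leNgt; apply/negP => ltr.
  have /ycl[z [/= xz yz]] : nbhs y [set z | dist y z < dist x y - r].
    by rewrite nbhsE; exists (dist x y - r) => //=; rewrite subr_gt0.
  by have := dD x z y; rewrite (dC z y) leNgt; move/negP; apply; lra.
exists B; split.
  move=> [n k]; have [[x cx]|nc] := pselect (exists x, c n x).
    by rewrite (BE _ _ _ cx).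
  suff -> : B (n, k) = set0 by exact: closed0.
  by apply/seteqP; split=> // y [x cx _]; apply: nc; exists x.
move=> x N; rewrite !nbhsE => -[e /= e0 eN].
have [k ke] : exists k : nat, k.+1%:R^-1 < e / 2.
  have e20 : 0 < e / 2 by rewrite divr_gt0.
  have := near_infty_natSinv_lt (PosNum e20).
  by case=> k _ /(_ k (leqnn k)); exists k.
have k0 : 0 < k.+1%:R^-1 :> R by rewrite invr_gt0.
set r := k.+1%:R^-1 in ke k0 *.
have xr : nbhs x [set y | dist x y < r] by rewrite nbhsE; exists r.
have [] := denseD ([set y | dist x y < r]^°) _ (@open_interior _ _).
  by exists x.
move=> z [/interior_subset /= xz Dz].
exists (g z, k).
  rewrite (BE _ _ z)//.
  exists (r - dist x z); first by rewrite /= subr_gt0.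
  by move=> y /= xy; have := dD z x y; rewrite (dC z x) -/r; lra.
rewrite (BE _ _ z)// => y /= zy; apply: eN => /=.
by have := dD x z y; rewrite -/r in zy; lra.
Qed.

(** Otherwise sequences of comparable points would converge to [x] and to [y]. *)
Lemma closed_order_near (R : realType) d (S : POrderedPointedTopological.type d) :
  completely_metrizable R S -> closed_order S ->
  forall x y : S, ~ (x <= y)%O -> \forall x' \near x & y' \near y, ~ (x' <= y')%O.
Proof.
move=> [dist [_ nbhsE _]] cord x y nxy; apply: contrapT => nnear.
pose r n : R := n.+1%:R^-1.
have r0 n : 0 < r n by rewrite invr_gt0.
have /choice[u] n : exists p : S * S,
    [/\ dist x p.1 < r n, dist y p.2 < r n & (p.1 <= p.2)%O].
  apply: contrapT => nex; apply: nnear.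
  exists ([set z | dist x z < r n], [set z | dist y z < r n]) => /=.
    by rewrite !nbhsE; split; exists (r n) => /=.
  by move=> [z t] /= [xz yt] zt; apply: nex; exists (z, t).
move=> /all_and3[ux uy uxy].
have cvgu (v : nat -> S) z : (forall n, dist z (v n) < r n) -> v @ \oo --> z.
  move=> zv A; rewrite /= nbhsE => -[e /= e0 eA].
  suff : \forall n \near \oo, A (v n) by [].
  near=> n; apply: eA => /=.
  apply: (lt_trans (zv n)); near: n.
  exact: (near_infty_natSinv_lt (PosNum e0)).
by apply: nxy; apply: (cord _ _ _ _ uxy); exact: cvgu.
Unshelve. all: by end_near. Qed.

Section closures.
Context d (S : POrderedPointedTopological.type d).
Implicit Types A : set S.

Definition upset A := forall x y : S, (x <= y)%O -> A x -> A y.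
Definition up A := [set y : S | exists2 x, A x & (x <= y)%O].
Definition down A := [set y : S | exists2 x, A x & (y <= x)%O].

Lemma upset_up A : upset (up A).
Proof. by move=> x y xy [z Az zx]; exists z => //; exact: le_trans xy. Qed.

Lemma upset_downC A : upset (~` down A).
Proof.
by move=> x y xy nAx [z Az yz]; apply: nAx; exists z => //; exact: le_trans yz.
Qed.

Lemma sub_up A : A `<=` up A. Proof. by move=> x; exists x. Qed.
Lemma sub_down A : A `<=` down A. Proof. by move=> x; exists x. Qed.

Hypothesis order_near : forall x y : S, ~ (x <= y)%O ->
  \forall x' \near x & y' \near y, ~ (x' <= y')%O.

(** If no point of [A] lies below [y], then near [y] this persists at each point of
    [A], and by compactness uniformly on [A]. *)
Lemma compact_closed_up A : compact A -> closed (up A).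
Proof.
move=> /compact_near_coveringP cA; rewrite -openC openE => y nAy /=.
have : \forall y' \near y, A `<=` [set x | ~ (x <= y')%O].
  apply: (cA S (nbhs y) (fun y' x => ~ (x <= y')%O)) => x Ax.
  by apply: order_near => xy; apply: nAy; exists x.
by apply: filterS => z Az [x Ax xz]; exact: Az Ax xz.
Qed.

Lemma compact_closed_down A : compact A -> closed (down A).
Proof.
move=> /compact_near_coveringP cA; rewrite -openC openE => y nAy /=.
have : \forall y' \near y, A `<=` [set x | ~ (y' <= x)%O].
  apply: (cA S (nbhs y) (fun y' x => ~ (y' <= x)%O)) => x Ax.
  have /order_near : ~ (y <= x)%O by move=> yx; apply: nAy; exists x.
  by move=> [[U V] /= [yU xV] UV]; exists (V, U) => // -[z t] /= [Vz Ut]; exact: (UV (t, z)).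
by apply: filterS => z Az [x Ax xz]; exact: Az Ax xz.
Qed.

End closures.

(** * Borel up-sets and the sigma-algebra they generate *)

Lemma closed_borel (T : ptopologicalType) (A : set T) :
  closed A -> @measurable _ (borel T) A.
Proof.
move=> clA; rewrite -[A]setCK; apply: measurableC.
by apply: sub_sigma_algebra; rewrite openC.
Qed.

Section updiff.
Context d (S : POrderedPointedTopological.type d).
Implicit Types A U V : set S.

Definition borel_upset U := @measurable _ (borel S) U /\ upset U.

(** Up-sets are stable under unions and intersections but not under complements;
    their differences form a semiring of sets. *)
Definition updiff : set (set S) := [set A | exists U V,
  [/\ borel_upset U, borel_upset V, V `<=` U & A = U `\` V]].

Lemma borel_upset0 : borel_upset set0. Proof. by split. Qed.
Lemma borel_upsetT : borel_upset setT. Proof. by split. Qed.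

Lemma borel_upsetI U V : borel_upset U -> borel_upset V -> borel_upset (U `&` V).
Proof.
move=> [mU uU] [mV uV]; split; first exact: measurableI.
by move=> x y xy [/(uU _ _ xy) ? /(uV _ _ xy)].
Qed.

Lemma borel_upsetU U V : borel_upset U -> borel_upset V -> borel_upset (U `|` V).
Proof.
move=> [mU uU] [mV uV]; split; first exact: measurableU.
by move=> x y xy [/(uU _ _ xy)|/(uV _ _ xy)]; [left|right].
Qed.

Lemma updiff_upset U : borel_upset U -> updiff U.
Proof.
by move=> uU; exists U, set0; rewrite setD0; split => //; exact: borel_upset0.
Qed.

Lemma updiff_diff U V : borel_upset U -> borel_upset V -> updiff (U `\` V).
Proof.
move=> uU uV; exists U, (U `&` V); split => //; [exact: borel_upsetI|].
apply/seteqP; split => x [Ux nV]; first by split=> // -[].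
by split=> // Vx; apply: nV.
Qed.

Lemma updiff_borel : updiff `<=` @measurable _ (borel S).
Proof. by move=> _ [U [V [[mU _] [mV _] _ ->]]]; exact: measurableD. Qed.

Lemma updiff0 : updiff set0. Proof. exact: updiff_upset borel_upset0. Qed.

Lemma updiffI : setI_closed updiff.
Proof.
move=> _ _ [U [V [uU uV _ ->]]] [U' [V' [uU' uV' _ ->]]].
have -> : (U `\` V) `&` (U' `\` V') = (U `&` U') `\` (V `|` V').
  apply/seteqP; split=> [x [[Ux nVx] [Ux' nVx']]|x [[Ux Ux'] nV]].
    by split => // -[].
  by split; split => // ?; apply: nV; [left|right].
by apply: updiff_diff; [exact: borel_upsetI|exact: borel_upsetU].
Qed.

(** Removing [U' `\` V'] from [U `\` V] leaves the points outside [U'] and those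
    inside [V']; these are disjoint because [V' `<=` U']. *)
Lemma updiffD : semi_setD_closed updiff.
Proof.
move=> _ _ [U [V [uU uV VU ->]]] [U' [V' [uU' uV' VU' ->]]].
pose A := U `\` (V `|` U'); pose B := (U `&` V') `\` V.
exists [set A; B]; split.
- exact: finite_set2.
- move=> _ [->|->]; apply: updiff_diff => //;
    [exact: borel_upsetU|exact: borel_upsetI].
- apply/seteqP; split=> [x [[Ux nVx] nU'V']|x [_ [->|->]]].
  + have [U'x|nU'x] := pselect (U' x).
      exists B; first by right.
      by split => //; split=> //; apply: contrapT => nV'x; exact: nU'V'.
    by exists A; [left|split => // -[]].
  + by move=> [Ux nVU]; split => [|[U'x _]]; [split=> // Vx|];
      apply: nVU; [left|right].
  + by move=> [[Ux V'x] nVx]; split => // -[].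
- have AB0 x : A x -> B x -> False.
    by move=> [_ nVU'] [[_ /VU' V'x] _]; apply: nVU'; right.
  by move=> X Y [->|->] [->|->] // [x []] => [Ax Bx|Bx Ax]; case: (AB0 x).
Qed.

End updiff.

Section generation.
Context d (S : POrderedPointedTopological.type d) (I : countType) (B : I -> set S).
Implicit Types A : set S.
Hypothesis cS : compact [set: S].
Hypothesis basisB : closed_basis B.
Hypothesis order_near : forall x y : S, ~ (x <= y)%O ->
  \forall x' \near x & y' \near y, ~ (x' <= y')%O.

Lemma closed_compactT (A : set S) : closed A -> compact A.
Proof. by move=> clA; exact: subclosed_compact cS _. Qed.

Lemma closed_up A : closed A -> closed (up A).
Proof. by move=> /closed_compactT; exact: compact_closed_up. Qed.

Lemma closed_down A : closed A -> closed (down A).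
Proof. by move=> /closed_compactT; exact: compact_closed_down. Qed.

Lemma borel_upset_up A : closed A -> borel_upset (up A).
Proof.
by move=> clA; split; [apply: closed_borel; exact: closed_up|exact: upset_up].
Qed.

Lemma borel_upset_downC A : closed A -> borel_upset (~` down A).
Proof.
move=> clA; split; last exact: upset_downC.
by apply: measurableC; apply: closed_borel; exact: closed_down.
Qed.

(** The countable family of closed up-sets and closed down-sets generated by the
    base. *)
Definition hull (p : I * bool) := if p.2 then up (B p.1) else down (B p.1).

(** By antisymmetry one of [x <= y] and [y <= x] fails, and then some closed
    neighbourhood of [y] avoids the points above, respectively below, [x]. *)
Lemma hull_separates (x y : S) : y <> x ->
  exists2 p, nbhs y (hull p) & ~ hull p x.
Proof.
move=> yx; have [xy|nxy] := pselect (x <= y)%O.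
  have nyx : ~ (y <= x)%O by move=> yx'; apply: yx; apply/le_anti/andP.
  have : \forall y' \near y, ~ (y' <= x)%O.
    have := order_near nyx; move=> [[U V] /= [yU xV] UV].
    by apply: filterS yU => z Uz; apply: (UV (z, x)); split => //; exact: nbhs_singleton.
  move=> /(proj2 basisB)[i yi iN]; exists (i, true) => /=.
    by apply: filterS yi; exact: sub_up.
  by move=> [z /iN + zx]; apply.
have : \forall y' \near y, ~ (x <= y')%O.
  have := order_near nxy; move=> [[U V] /= [xU yV] UV].
  by apply: filterS yV => z Vz; apply: (UV (x, z)); split => //; exact: nbhs_singleton.
move=> /(proj2 basisB)[i yi iN]; exists (i, false) => /=.
  by apply: filterS yi; exact: sub_down.
by move=> [z /iN + zx]; apply.
Qed.

(** Given [x] in an open [O], compactness covers the complement of [O] by finitely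
    many hulls that avoid [x].  So [O] is a union of finite intersections of
    complements of hulls, and there are only countably many of these. *)
Lemma open_sub_updiff_sigma : @open S `<=` <<s @updiff d S >>.
Proof.
move=> O oO.
pose C (s : seq (I * bool)) := \bigcap_(p in [set` s]) ~` hull p.
have -> : O = \bigcup_(s in [set s | C s `<=` O]) C s.
  apply/seteqP; split=> [x Ox|x [s sO]]; last exact: sO.
  have := closed_compactT (open_closedC oO); rewrite compact_cover.
  move=> /(_ _ [set p | ~ hull p x] (fun p => (hull p)^°)) [].
  - by move=> i _; exact: open_interior.
  - move=> y nOy; have [yx|p yp px] := @hull_separates x y.
      by move: nOy; rewrite yx.
    by exists p.
  - move=> D Dx OD; exists (finmap.enum_fset D) => [y Cy|p /= pD].
      apply: contrapT => /OD[p pD /interior_subset]; exact: Cy.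
    by have := Dx p pD; rewrite inE.
have hull_mem p : <<s @updiff d S >> (hull p).
  rewrite /hull; case: p => i [] /=; apply: sub_sigma_algebra.
    by apply: updiff_upset; apply: borel_upset_up; exact: (proj1 basisB).
  rewrite -[down _]setCK -setTD; apply: updiff_diff; first exact: borel_upsetT.
  by apply: borel_upset_downC; exact: (proj1 basisB).
rewrite bigcup_mkcond.
apply: (@countable_bigcupT_measurable _ (g_sigma_algebraType (@updiff d S))) => //.
move=> s; case: ifP => _; last exact: measurable0.
apply: fin_bigcap_measurable; first exact: finite_seq.
by move=> p _; apply: measurableC; exact: hull_mem.
Qed.

End generation.

(** * Regularity of Borel probability measures *)

Lemma bigcup_tail_lt d (T : measurableType d) (R : realType) (m : probability T R)
    (F : nat -> set T) (e : R) : (forall n, measurable (F n)) -> 0 < e ->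
  exists N, (m ((\bigcup_n F n) `\` (\bigcup_(n < N) F n)) < e%:E)%E.
Proof.
move=> mF e0.
pose G N := (\bigcup_n F n) `\` (\bigcup_(n < N) F n).
have mG N : measurable (G N).
  by apply: measurableD; [exact: bigcupT_measurable|exact: bigcup_measurable].
have G0 : \bigcap_N G N = set0.
  apply/seteqP; split=> // x Gx; have [[n _ Fnx] _] := Gx 0%N I.
  by have [_] := Gx n.+1 I; apply; exists n => /=.
have : m (G N) @[N --> \oo] --> 0%E.
  rewrite -(measure0 m) -G0; apply: nonincreasing_cvg_mu => //.
  - by rewrite (le_lt_trans (probability_le1 m (mG 0%N)))// ltry.
  - by rewrite G0.
  - move=> k n kn; apply/subsetPset => x [Fx nFx]; split => // -[j /= jk Fj].
    by apply: nFx; exists j => //=; exact: leq_trans kn.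
move=> /fine_cvgP[_ /cvgr_lt /(_ _ e0)][N _ /(_ N (leqnn N)) /= GN].
by exists N; rewrite -[m _]fineK ?lte_fin// fin_num_measure//; exact: mG.
Qed.

Section regularity.
Context (R : realType) (T : ptopologicalType) (J : countType) (B : J -> set T).
Hypothesis basisB : closed_basis B.
Variable m : probability (borel T) R.

(** Approximation from inside and from outside at once, which makes the notion
    stable under complements. *)
Definition regular (A : set T) := forall e : R, 0 < e -> exists K O,
  [/\ closed K, open O, K `<=` A, A `<=` O &
      (m (O `\` K : set (borel T)) < e%:E)%E].

Let open_borel (O : set T) : open O -> measurable (O : set (borel T)).
Proof. exact: sub_sigma_algebra. Qed.

Lemma regularC A : regular A -> regular (~` A).
Proof.
move=> rA e /rA[K [V [clK oV KA AV mVK]]]; exists (~` V), (~` K); split.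
- exact: open_closedC.
- exact: closed_openC.
- exact: subsetC.
- exact: subsetC.
- by rewrite setDE setCK setIC -setDE.
Qed.

(** An open set is the union of the base elements that it contains. *)
Lemma regular_open O : open O -> regular O.
Proof.
move=> oO e e0.
pose F n := if unpickle n is Some i then if `[< B i `<=` O >] then B i else set0
            else set0.
have clF n : closed (F n).
  rewrite /F; case: unpickle => [i|]; last exact: closed0.
  by case: asboolP => _; [exact: (proj1 basisB)|exact: closed0].
have OE : O = \bigcup_n F n.
  apply/seteqP; split=> [x Ox|x [n _]].
    have [i xi iO] := proj2 basisB _ _ (open_nbhs_nbhs (conj oO Ox)).
    exists (pickle i) => //; rewrite /F pickleK; case: asboolP => // _.
    exact: nbhs_singleton.
  by rewrite /F; case: unpickle => // i; case: asboolP => // iO /iO.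
have [N mN] := bigcup_tail_lt m (fun n => closed_borel (clF n)) e0.
exists (\bigcup_(n < N) F n), O; split => //; last by rewrite {1}OE.
  by apply: closed_bigcup => //; exact: finite_II.
by rewrite OE => x [n _]; exists n.
Qed.

(** Half of [e] is shared among the approximations of the sets [A n]; the other
    half pays for keeping only finitely many of the inner closed sets, since an
    infinite union of them need not be closed. *)
Lemma regular_bigcup (A : nat -> set T) :
  (forall n, regular (A n)) -> regular (\bigcup_n A n).
Proof.
move=> rA e e0; have e20 : 0 < e / 2 by rewrite divr_gt0.
have ek n : 0 < e / 2 / (2 ^ n.+1)%:R by rewrite divr_gt0// ltr0n expn_gt0.
have /choice[p /all_and5[clK oV KA AV mVK]] n : exists p : set T * set T,
    [/\ closed p.1, open p.2, p.1 `<=` A n, A n `<=` p.2 &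
      (m (p.2 `\` p.1 : set (borel T)) < (e / 2 / (2 ^ n.+1)%:R)%:E)%E].
  by have [K [V ?]] := rA n _ (ek n); exists (K, V).
have mK n := closed_borel (clK n); have mV n := open_borel (oV n).
have [N mN] := bigcup_tail_lt m mK e20.
pose K := \bigcup_(n < N) (p n).1; pose V := \bigcup_n (p n).2.
exists K, V; split.
- by apply: closed_bigcup => //; exact: finite_II.
- by apply: bigcup_open.
- by move=> x [n _ /KA Ax]; exists n.
- by move=> x [n _ /AV Ax]; exists n.
pose D1 := \bigcup_n ((p n).2 `\` (p n).1) : set (borel T).
pose D2 := ((\bigcup_n (p n).1) `\` K) : set (borel T).
have mp n : measurable ((p n).2 `\` (p n).1 : set (borel T)) by exact: measurableD.
have mD1 : measurable D1 by exact: bigcupT_measurable.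
have mD2 : measurable D2.
  by apply: measurableD; [exact: bigcupT_measurable|exact: bigcup_measurable].
have sub : V `\` K `<=` D1 `|` D2.
  move=> x [[n _ Vx] nK]; have [Kx|nKx] := pselect ((p n).1 x).
    by right; split => //; exists n.
  by left; exists n.
apply: (@le_lt_trans _ _ (m (D1 `|` D2))).
  apply: le_measure; rewrite ?inE//; last exact: measurableU.
  by apply: measurableD; [exact: bigcupT_measurable|exact: bigcup_measurable].
apply: (@le_lt_trans _ _ (m D1 + m D2)%E); first exact: measureU2.
rewrite (splitr e) EFinD; apply: lee_ltD => //.
  by rewrite fin_num_measure.
apply: (@le_trans _ _ (\sum_(n <oo) m ((p n).2 `\` (p n).1 : set (borel T)))%E).
  exact: measure_sigma_subadditive.
apply: (le_trans _ (epsilon_trick0 xpredT (ltW e20))).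
by apply: lee_nneseries => // n _; exact/ltW/mVK.
Qed.

(** The regular sets form a sigma-algebra that contains the open sets. *)
Theorem borel_regular A : @measurable _ (borel T) A -> regular A.
Proof.
suff : <<s @open T >> `<=` regular by exact.
apply: smallest_sub; last exact: regular_open.
split => /=.
- by move=> e e0; exists set0, set0; rewrite set0D measure0 lte_fin; split => //;
    [exact: closed0|exact: open0].
- by move=> X rX; rewrite setTD; exact: regularC.
- exact: regular_bigcup.
Qed.

End regularity.

(** * Limits of uniformly Cauchy sequences on up-sets *)

(** A copy of [S] whose sets of interest are the differences of Borel up-sets. *)
Definition updiff_type d (S : POrderedPointedTopological.type d) : Type := S.

HB.instance Definition _ d (S : POrderedPointedTopological.type d) :=
  Pointed.on (updiff_type S).

HB.instance Definition _ d (S : POrderedPointedTopological.type d) :=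
  isSemiRingOfSets.Build default_measure_display (updiff_type S)
    (@updiff0 d S) (@updiffI d S) (@updiffD d S).

Section completeness.
Context (R : realType) d (S : POrderedPointedTopological.type d)
  (J : countType) (B : J -> set S).
Hypothesis cS : compact [set: S].
Hypothesis basisB : closed_basis B.
Hypothesis order_near : forall x y : S, ~ (x <= y)%O ->
  \forall x' \near x & y' \near y, ~ (x' <= y')%O.
Variables (m_ : nat -> probability (borel S) R) (r : nat -> R).
Hypothesis r0 : r @ \oo --> 0.
Hypothesis m_cauchy : forall n k U, (n <= k)%N -> borel_upset U ->
  `|fine (m_ n U) - fine (m_ k U)| <= r n.

Let mu n (A : set (borel S)) : R := fine (m_ n A).

Let muE n A : measurable A -> m_ n A = (mu n A)%:E.
Proof. by move=> mA; rewrite fineK// fin_num_measure. Qed.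

Let le_mu n (A C : set (borel S)) :
  measurable A -> measurable C -> A `<=` C -> mu n A <= mu n C.
Proof.
by move=> mA mC AC; rewrite -lee_fin -!muE//; apply: le_measure; rewrite ?inE.
Qed.

(** A difference of nested up-sets loses only a factor 2; unions of many such
    differences would lose more, so the convergence is uniform on [updiff] but
    not on the ring it generates. *)
Let mu_cauchy_diff n k A : (n <= k)%N -> updiff A -> `|mu n A - mu k A| <= 2 * r n.
Proof.
move=> nk [U [V [uU uV VU ->]]].
have muD i : mu i (U `\` V) = mu i U - mu i V.
  apply: EFin_inj; rewrite EFinB -!muE; [|exact: uV.1|exact: uU.1|]; last first.
    by apply: measurableD; [exact: uU.1|exact: uV.1].
  rewrite measureD; [|exact: uU.1|exact: uV.1|]; last first.
    by rewrite (le_lt_trans (probability_le1 _ uU.1))// ltry.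
  by rewrite setIidr.
have := m_cauchy nk uU; have := m_cauchy nk uV; rewrite !muD -!/(mu _ _).
by rewrite !ler_norml => /andP[? ?] /andP[? ?]; apply/andP; split; lra.
Qed.

Definition ell (A : set (borel S)) := lim (mu n A @[n --> \oo]).

Let cvg_ell A : updiff A -> mu n A @[n --> \oo] --> ell A.
Proof.
move=> uA; rewrite /ell; apply/cauchy_cvgP/cauchy_exP => e e0.
have e20 : 0 < e / 2 by rewrite divr_gt0.
have := cvgr_lt _ r0 _ e20; move=> [n _ /(_ n (leqnn n)) /= rn].
exists (mu n A); exists n => // k /= nk; rewrite /ball /=.
by rewrite (le_lt_trans (mu_cauchy_diff nk uA))//; lra.
Qed.

Let ell_dist n A : updiff A -> `|mu n A - ell A| <= 2 * r n.
Proof.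
move=> uA; have cv : `|mu n A - mu k A| @[k --> \oo] --> `|mu n A - ell A|.
  by apply: cvg_norm; apply: cvgB; [exact: cvg_cst|exact: cvg_ell].
apply: (cvgr_to_le cv).
by exists n => // k /= nk; exact: mu_cauchy_diff.
Qed.
Let ell_ge0 A : updiff A -> 0 <= ell A.
Proof.
move=> uA; apply: (cvgr_to_ge (cvg_ell uA)); apply: nearW => n.
by rewrite fine_ge0.
Qed.

Let le_ell A C : updiff A -> updiff C -> A `<=` C -> ell A <= ell C.
Proof.
move=> uA uC AC; apply: (ler_cvg_to (cvg_ell uA) (cvg_ell uC)).
by apply: nearW => n; apply: le_mu => //; exact: updiff_borel.
Qed.

(** On [updiff] the limit is nonnegative and the absolute value changes nothing;
    it keeps the set function nonnegative on the sets where [ell] is the default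
    value of a limit that may not exist. *)
Definition lam (A : set (updiff_type S)) : \bar R := (`|ell A|)%:E.

Let lamE A : updiff A -> lam A = (ell A)%:E.
Proof. by move=> uA; rewrite /lam ger0_norm// ell_ge0. Qed.

Let lam_ge0 A : (0 <= lam A)%E. Proof. by rewrite lee_fin. Qed.

Let lam_semi_additive : measure_function.semi_additive lam.
Proof.
move=> F n uF tF uUF; rewrite lamE//.
rewrite (eq_bigr (fun i : 'I_n => (ell (F i))%:E)) => [|i _]; last exact: lamE (uF i).
rewrite sumEFin; congr EFin.
rewrite [LHS]/ell; apply: cvg_lim => //=.
have -> : (fun k => mu k (\big[setU/set0]_(i < n) F i)) =
    (fun k => \sum_(i < n) mu k (F i)).
  apply/funext => k; apply: EFin_inj.
  rewrite -sumEFin -muE; last exact: updiff_borel.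
  rewrite measure_semi_additive//; first last.
  - exact: updiff_borel.
  - by move=> i; exact: updiff_borel (uF i).
  by apply: eq_bigr => i _; apply: muE; exact: updiff_borel (uF i).
apply: (@cvg_big _ _ +%R); first exact: add_continuous.
by move=> i _; exact: cvg_ell (uF i).
Qed.

HB.instance Definition _ := isContent.Build _ (updiff_type S) R lam
  lam_ge0 lam_semi_additive.

(** The inner approximation of an up-set can be replaced by its up-closure, and
    the outer one by the complement of the down-closure of its complement: both
    remain on the right side of [U] because [U] is an up-set. *)
Let upset_regular n U e : borel_upset U -> 0 < e -> exists K O,
  [/\ borel_upset K, borel_upset O, closed K /\ open O, K `<=` U /\ U `<=` O &
      mu n (O `\` K) < e].
Proof.
move=> [mU uU] e0; have [K [V [clK oV KU UV mVK]]] := borel_regular basisB (m_ n) mU e0.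
have clV := open_closedC oV.
have bK := borel_upset_up cS order_near clK.
have bV := borel_upset_downC cS order_near clV.
exists (up K), (~` down (~` V)); split => //.
- by split; [exact: closed_up|exact/closed_openC/closed_down].
- split=> [x [y /KU + yx]|x Ux [y + xy]]; first exact: uU.
  by apply; apply/UV/(uU _ _ xy).
- rewrite -lte_fin -muE; last by apply: measurableD; [exact: bV.1|exact: bK.1].
  apply: le_lt_trans mVK; apply: le_measure; rewrite ?inE.
  + by apply: measurableD; [exact: bV.1|exact: bK.1].
  + by apply: measurableD; [exact: sub_sigma_algebra|exact: closed_borel].
  + move=> x [nVx nKx]; split; last by move=> /sub_up.
    by apply: contrapT => nVx'; apply: nVx; exact: sub_down.
Qed.

(** Regularity of one measure [m_ n] close enough to the limit is inherited by the
    limit, since [mu n] and [ell] differ by at most [2 * r n] on [updiff]. *)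
Let updiff_regular A e : updiff A -> 0 < e -> exists K O,
  [/\ updiff K, updiff O, closed K /\ open O, K `<=` A /\ A `<=` O &
      ell O <= ell K + e].
Proof.
move=> [U [V [uU uV VU ->]]] e0.
have e8 : 0 < e / 8 by rewrite divr_gt0.
have := cvgr_lt _ r0 _ e8; move=> [n _ /(_ n (leqnn n)) /= rn].
have [K1 [U1 [bK1 bU1 [cK1 oU1] [KU1 UU1] mu1]]] := upset_regular n uU e8.
have [K2 [U2 [bK2 bU2 [cK2 oU2] [KU2 UU2] mu2]]] := upset_regular n uV e8.
have uK : updiff (K1 `\` U2) by exact: updiff_diff.
have uO : updiff (U1 `\` K2) by exact: updiff_diff.
exists (K1 `\` U2), (U1 `\` K2); split => //.
- by rewrite !setDE; split; [apply: closedI => //; exact: open_closedC|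
                            apply: openI => //; exact: closed_openC].
- by split=> x [/= x1 x2]; split; [exact: KU1|move=> /UU2|exact: UU1|move=> /KU2].
have mD1 : measurable (U1 `\` K1 : set (borel S)) by apply: measurableD; [exact: bU1.1|exact: bK1.1].
have mD2 : measurable (U2 `\` K2 : set (borel S)) by apply: measurableD; [exact: bU2.1|exact: bK2.1].
have le1 : mu n (U1 `\` K2) <= mu n (K1 `\` U2) + mu n (U1 `\` K1) + mu n (U2 `\` K2).
  have mK := updiff_borel uK; have mO := updiff_borel uO.
  rewrite -lee_fin !EFinD -!muE//.
  apply: (@le_trans _ _ (m_ n (((K1 `\` U2) `|` (U1 `\` K1)) `|` (U2 `\` K2)))).
    apply: le_measure; rewrite ?inE//; first by do 2 apply: measurableU => //.
    move=> x [U1x nK2x]; have [U2x|nU2x] := pselect (U2 x); first by right.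
    by left; have [K1x|nK1x] := pselect (K1 x); [left|right].
  apply: le_trans (measureU2 _ _ _) _ => //; first exact: measurableU.
  by rewrite leeD2r//; exact: measureU2.
have := ell_dist n uK; have := ell_dist n uO.
by rewrite !ler_norml => /andP[? ?] /andP[? ?]; lra.
Qed.

(** The compact-class argument: a closed set inside [A] is covered by finitely many
    of the open sets around the [F n], and finite subadditivity is inherited
    from the measures [m_ n]. *)
Let lam_sigma_subadditive : measurable_subset_sigma_subadditive lam.
Proof.
move=> A F uF uA AF.
apply/lee_addgt0Pr => e e0; have e20 : 0 < e / 2 by rewrite divr_gt0.
have ek n : 0 < e / 2 / (2 ^ n.+1)%:R by rewrite divr_gt0// ltr0n expn_gt0.
have [K [V0 [uK uV0 [clK _] [KA AV0] V0K]]] := updiff_regular uA e20.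
have /choice[V] n : exists V, [/\ updiff V, open V, F n `<=` V &
    ell V <= ell (F n) + e / 2 / (2 ^ n.+1)%:R].
  have [K' [V [uK' uV [_ oV] [KF FV] VK]]] := updiff_regular (uF n) (ek n).
  exists V; split => //; apply: (le_trans VK); rewrite lerD2r.
  exact: le_ell uK' (uF n) KF.
move=> /all_and4[uV oV FV VF].
have := closed_compactT cS clK; rewrite compact_cover.
move=> /(_ _ [set: nat] V) [].
- by move=> n _; exact: oV.
- by move=> x /KA /AF [n _ /FV Vx]; exists n.
move=> D _ KD.
pose N := (\max_(i <- finmap.enum_fset D) i).+1.
have KN : K `<=` \big[setU/set0]_(i < N) V i.
  move=> x /KD[i /= iD Vix]; rewrite -bigcup_mkord; exists i => //=.
  by rewrite ltnS; exact: leq_bigmax_seq.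
have KV : ell K <= \sum_(i < N) ell (V i).
  have cv : \sum_(i < N) mu n (V i) @[n --> \oo] --> \sum_(i < N) ell (V i).
    apply: (@cvg_big _ _ +%R); first exact: add_continuous.
    by move=> i _; exact: cvg_ell (uV i).
  apply: (ler_cvg_to (cvg_ell uK) cv); apply: nearW => n.
  rewrite -lee_fin -sumEFin -muE; last exact: updiff_borel uK.
  rewrite (eq_bigr (fun i : 'I_N => m_ n (V i))); last first.
    by move=> i _; apply/esym/muE; exact: updiff_borel (uV i).
  apply: content_subadditive => //; last exact: updiff_borel uK.
  by move=> k _; exact: updiff_borel (uV k).
apply: (@le_trans _ _ ((ell K)%:E + (e / 2)%:E)%E).
  by rewrite lamE// -EFinD lee_fin (le_trans _ V0K)//; exact: le_ell uA uV0 AV0.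
rewrite [in leRHS](splitr e) EFinD addeA leeD2r//.
apply: (le_trans _ (epsilon_trick xpredT (fun n => lam_ge0 (F n)) (ltW e20))).
apply: (@le_trans _ _ (\sum_(0 <= i < N) (lam (F i) + (e / 2 / (2 ^ i.+1)%:R)%:E))%E); last first.
  by apply: nneseries_lim_ge => n _ _; rewrite adde_ge0// lee_fin ltW.
rewrite big_mkord (le_trans (y := (\sum_(i < N) ell (V i))%:E))//.
rewrite -sumEFin; apply: lee_sum => i _.
by rewrite lamE ?lee_fin; [exact: VF|exact: uF].
Qed.

HB.instance Definition _ := Content_SigmaSubAdditive_isMeasure.Build _ _ _
  lam lam_sigma_subadditive.

Let borel_updiff (A : set S) : @measurable _ (borel S) A ->
  @measurable _ (g_sigma_algebraType (@measurable _ (updiff_type S))) A.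
Proof.
suff : <<s @open S >> `<=` <<s @updiff d S >> by move=> /(_ A).
apply: smallest_sub; first exact: smallest_sigma_algebra.
exact: (open_sub_updiff_sigma cS basisB order_near).
Qed.

(** The Caratheodory extension, read on the Borel sets. *)
Definition lam_ext (A : set (borel S)) : \bar R := measure_extension lam A.

Let lam_ext0 : lam_ext set0 = 0%E. Proof. exact: measure0. Qed.
Let lam_ext_ge0 A : (0 <= lam_ext A)%E. Proof. exact: measure_ge0. Qed.
Let lam_ext_sigma_additive : semi_sigma_additive lam_ext.
Proof.
move=> F mF tF mUF; apply: measure_semi_sigma_additive => //.
- by move=> i; exact: borel_updiff (mF i).
- exact: borel_updiff mUF.
Qed.

HB.instance Definition _ := isMeasure.Build _ _ _ lam_ext
  lam_ext0 lam_ext_ge0 lam_ext_sigma_additive.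

Let lam_extE A : updiff A -> lam_ext A = (ell A)%:E.
Proof.
by move=> uA; rewrite -lamE// /lam_ext /measure_extension measurable_mu_extE.
Qed.

Let lam_extT : lam_ext setT = 1%E.
Proof.
have uT : updiff [set: S] by exact: updiff_upset (@borel_upsetT d S).
rewrite lam_extE//; congr EFin; rewrite /ell; apply: cvg_lim => //=.
by under eq_cvg do rewrite /mu probability_setT; exact: cvg_cst.
Qed.

HB.instance Definition _ := Measure_isProbability.Build _ _ _ lam_ext lam_extT.

(** Completeness of the uniform distance over Borel up-sets. *)
Theorem upset_cauchy_limit : exists phi : probability (borel S) R,
  forall n U, borel_upset U -> `|fine (m_ n U) - fine (phi U)| <= r n.
Proof.
exists lam_ext => n U uU; have uU' := updiff_upset uU.
change (`|mu n U - fine (lam_ext U)| <= r n); rewrite lam_extE//=.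
have cv : `|mu n U - mu k U| @[k --> \oo] --> `|mu n U - ell U|.
  by apply: cvg_norm; apply: cvgB; [exact: cvg_cst|exact: cvg_ell].
apply: (cvgr_to_le cv).
by exists n => // k /= nk; exact: m_cauchy.
Qed.

End completeness.

(** * Bounded measurable functions and their linear functionals *)

Section bounded_functions.
Context d (T : measurableType d) (R : realType).
Implicit Types (f g h : T -> R) (D A : set T).

Definition bounded_measurable f :=
  measurable_fun [set: T] f /\ exists M, forall x, `|f x| <= M.

Lemma bounded_measurable_affine (c : R) f g : bounded_measurable f ->
  bounded_measurable g -> bounded_measurable (fun x => c * f x + g x).
Proof.
move=> [mf [M fM]] [mg [K gK]]; split.
  by apply: measurable_funD => //; exact: measurable_funM.
exists (`|c| * M + K) => x; rewrite (le_trans (ler_normD _ _))// lerD//.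
by rewrite normrM ler_wpM2l.
Qed.

Lemma bounded_measurable_cst c : bounded_measurable (fun=> c).
Proof. by split => //; exists `|c|. Qed.

Lemma bounded_measurable_indic A : measurable A -> bounded_measurable \1_A.
Proof.
move=> mA; split => //; exists 1 => x; rewrite indicE.
by case: (_ \in _); rewrite ?normr1 ?normr0.
Qed.

Section integrals.
Variables (mu : {measure set T -> \bar R}) (mu1 : (mu [set: T] <= 1)%E).

Lemma bounded_measurable_integrable D f : measurable D -> bounded_measurable f ->
  mu.-integrable D (EFin \o f).
Proof.
move=> mD [mf [M fM]]; apply: measurable_bounded_integrable => //.
- apply: (@le_lt_trans _ _ 1%E); last exact: ltry.
  by apply: le_trans mu1; apply: le_measure; rewrite ?inE.
- exact: measurable_funTS.
- exists M; split; first exact: num_real.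
  by move=> K MK x _; rewrite /= (le_trans (fM x))// ltW.
Qed.

Lemma Rintegral_affine D (c : R) f g : measurable D ->
    bounded_measurable f -> bounded_measurable g ->
  \int[mu]_(x in D) (c * f x + g x) =
  c * \int[mu]_(x in D) f x + \int[mu]_(x in D) g x.
Proof.
move=> mD bf bg; have b0 := bounded_measurable_cst 0.
have int_f := bounded_measurable_integrable mD bf.
rewrite RintegralD//; first by rewrite RintegralZl.
- have := bounded_measurable_affine c bf b0.
  under [X in bounded_measurable X]eq_fun do rewrite addr0.
  exact: bounded_measurable_integrable.
- exact: bounded_measurable_integrable.
Qed.

Lemma norm_Rintegral_le D f (M : R) : measurable D -> bounded_measurable f ->
  (forall x, `|f x| <= M) -> `|\int[mu]_(x in D) f x| <= M * fine (mu D).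
Proof.
move=> mD bf fM; have bM := bounded_measurable_cst M.
have int_f := bounded_measurable_integrable mD bf.
rewrite (le_trans (le_normr_Rintegral mD int_f))//.
rewrite -Rintegral_cst//; apply: le_Rintegral => //.
  exact: integrable_norm int_f.
exact: bounded_measurable_integrable bM.
Qed.

Lemma fine_measure_le1 D : measurable D -> 0 <= fine (mu D) <= 1.
Proof.
move=> mD; have muD1 : (mu D <= 1)%E.
  by apply: le_trans mu1; apply: le_measure; rewrite ?inE.
rewrite fine_ge0//= -lee_fin fineK// ge0_fin_numE//.
by rewrite (le_lt_trans muD1)// ltry.
Qed.

Lemma norm_Rintegral_le1 D f (M : R) : measurable D -> bounded_measurable f ->
  (forall x, `|f x| <= M) -> `|\int[mu]_(x in D) f x| <= M.
Proof.
move=> mD bf fM; have M0 : 0 <= M by rewrite (le_trans _ (fM point)).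
apply: (le_trans (norm_Rintegral_le mD bf fM)).
by rewrite ler_piMr//; case/andP: (fine_measure_le1 mD).
Qed.

Lemma Rintegral_indic D A : measurable D -> measurable A ->
  \int[mu]_(x in D) \1_A x = fine (mu (A `&` D)).
Proof. by move=> mD mA; rewrite /Rintegral integral_indic. Qed.

End integrals.

Definition superlevel h (s : R) := [set x | s <= h x].

Lemma measurable_superlevel h s : measurable_fun setT h -> measurable (superlevel h s).
Proof.
move=> mh; rewrite -[superlevel _ _]setTI.
have -> : superlevel h s = h @^-1` `[s, +oo[.
  by apply/seteqP; split=> x /=; rewrite in_itv/= andbT.
by apply: mh => //; exact: measurable_itv.
Qed.

(** The sum counts the integers [k < N] with [k + 1 <= N * y], that is, it is the
    integer part of [N * y]. *)
Lemma sum_superlevel (y : R) (N : nat) : 0 <= y -> y <= 1 -> (0 < N)%N ->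
  `|y - N%:R^-1 * \sum_(k < N) (k.+1%:R / N%:R <= y)%R%:R| <= N%:R^-1.
Proof.
move=> y0 y1 N0; have N0' : 0 < N%:R :> R by rewrite ltr0n.
set n := Num.truncn (N%:R * y).
have /andP[ny yn] : (n%:R <= N%:R * y < n.+1%:R) by apply: truncn_itv; rewrite mulr_ge0.
have nN : (n <= N)%N.
  by rewrite -(ler_nat R) (le_trans ny)// ler_piMr// ltW.
have -> : \sum_(k < N) (k.+1%:R / N%:R <= y)%R%:R = n%:R :> R.
  transitivity (\sum_(k < N | (k < n)%N) 1 : R).
    rewrite [RHS]big_mkcond; apply: eq_bigr => k _.
    rewrite ler_pdivrMr// mulrC; case: ltnP => kn.
      by rewrite (le_trans _ ny)// ler_nat.
    by rewrite leNgt (lt_le_trans yn)// ler_nat.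
  by rewrite -(big_ord_widen _ (fun=> 1 : R) nN) sumr_const card_ord.
have -> : y - N%:R^-1 * n%:R = N%:R^-1 * (N%:R * y - n%:R).
  by rewrite mulrBr mulKf// gt_eqF.
have N0'' : 0 <= N%:R^-1 :> R by rewrite invr_ge0 ltW.
rewrite ger0_norm; last by rewrite mulr_ge0 ?subr_ge0.
rewrite -[leRHS]mulr1 ler_wpM2l//.
by rewrite lerBlDl; move: yn; rewrite -natr1 => /ltW.
Qed.

Section functional.
Variables (Phi : (T -> R) -> R) (K : R).
Hypothesis Phi_affine : forall (c : R) f g, bounded_measurable f ->
  bounded_measurable g -> Phi (fun x => c * f x + g x) = c * Phi f + Phi g.
Hypothesis Phi_bounded : forall f (M : R), bounded_measurable f ->
  (forall x, `|f x| <= M) -> `|Phi f| <= K * M.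

(** [h] is within [1 / N] of an average of [N] indicators of its superlevel sets,
    and [Phi] is bounded by [c] on each of these.  This reduces statements about
    increasing functions to up-sets, and statements about functions of [X s] to
    events. *)
Lemma functional_superlevel_le h (c : R) : measurable_fun setT h ->
  (forall x, 0 <= h x <= 1) ->
  (forall s, `|Phi \1_(superlevel h s)| <= c) -> `|Phi h| <= c.
Proof.
move=> mh h01 Phic.
have bh : bounded_measurable h.
  by split => //; exists 1 => x; have /andP[? ?] := h01 x; rewrite ger0_norm.
have bi s : bounded_measurable (\1_(superlevel h s) : T -> R).
  by apply: bounded_measurable_indic; exact: measurable_superlevel.
have Phi0 : Phi (fun=> 0) = 0.
  have := Phi_affine 1 (bounded_measurable_cst 0) (bounded_measurable_cst 0).
  by under [X in Phi X]eq_fun do rewrite mulr0 addr0; lra.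
pose hs (t : nat -> R) n x := \sum_(k < n) (\1_(superlevel h (t k)) x : R).
have bhs t n : bounded_measurable (hs t n) /\ `|Phi (hs t n)| <= c *+ n.
  elim: n => [|n [IHb IHc]].
    have -> : hs t 0 = fun=> 0 by apply/funext => x; rewrite /hs big_ord0.
    by rewrite Phi0 normr0; split => //; exact: bounded_measurable_cst.
  have -> : hs t n.+1 = fun x => 1 * hs t n x + \1_(superlevel h (t n)) x.
    by apply/funext => x; rewrite /hs big_ord_recr/= mul1r.
  split; first exact: bounded_measurable_affine.
  by rewrite Phi_affine// mul1r mulrSr (le_trans (ler_normD _ _))// lerD.
have approx n : `|Phi h| <= c + K * n.+1%:R^-1.
  pose t k : R := k.+1%:R / n.+1%:R; have [bt ct] := bhs t n.+1.
  pose g x := - n.+1%:R^-1 * hs t n.+1 x + h x.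
  have bg : bounded_measurable g by exact: bounded_measurable_affine.
  have -> : h = fun x => n.+1%:R^-1 * hs t n.+1 x + g x.
    by apply/funext => x; rewrite /g; ring.
  rewrite Phi_affine// (le_trans (ler_normD _ _))// lerD//.
    rewrite normrM ger0_norm ?invr_ge0// mulrC ler_pdivrMr ?ltr0n//.
    by rewrite mulr_natr.
  apply: Phi_bounded => // x; rewrite /g addrC mulNr.
  have /andP[h0 h1] := h01 x.
  have := sum_superlevel h0 h1 (ltn0Sn n); congr (`|_ - _ * _| <= _).
  by apply: eq_bigr => k _; rewrite indicE; congr ((nat_of_bool _)%:R); apply/idP/idP; rewrite inE.
rewrite leNgt; apply/negP => cPhi.
have cv : c + K * n.+1%:R^-1 @[n --> \oo] --> c + K * 0.
  by apply: cvgD; [exact: cvg_cst|apply: cvgMr; exact: cvg_harmonic].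
have : `|Phi h| <= c + K * 0 by apply: (cvgr_to_ge cv); exact: nearW.
by rewrite mulr0 addr0 leNgt cPhi.
Qed.

(** An affine change of variable brings [h] into [[0, 1]], where the previous lemma
    applies with [c = 0]. *)
Lemma functional_indic_eq0 h : bounded_measurable h ->
  (forall A, measurable A -> Phi \1_A = 0) -> Phi h = 0.
Proof.
move=> [mh [M hM]] Phi0.
have M0 : 0 <= M by rewrite (le_trans _ (hM point)).
(* [M + 1] rather than [M], since [M] may vanish. *)
pose g x := (2 * (M + 1))^-1 * h x + 2^-1.
have M1 : 0 < 2 * (M + 1) by lra.
have bh : bounded_measurable h by split => //; exists M.
have bg : bounded_measurable g.
  by apply: bounded_measurable_affine => //; exact: bounded_measurable_cst.
have g01 x : 0 <= g x <= 1.
  have : `|(2 * (M + 1))^-1 * h x| <= 2^-1.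
    have M1' : 0 <= (2 * (M + 1))^-1 by rewrite invr_ge0 ltW.
    rewrite normrM (ger0_norm M1') [leLHS]mulrC ler_pdivrMr//.
    by have := hM x; lra.
  by rewrite ler_norml /g => /andP[? ?]; apply/andP; split; lra.
have Phig : Phi g = 0.
  apply/normr0_eq0/le_anti; rewrite normr_ge0 andbT.
  apply: functional_superlevel_le => //; first exact: bg.1.
  by move=> s; rewrite Phi0 ?normr0//; apply: measurable_superlevel; exact: bg.1.
have Phi1 : Phi (fun=> 1) = 0.
  by rewrite -(Phi0 _ measurableT); congr Phi; apply/funext => x; rewrite indicT.
have hE : h = fun x => 2 * (M + 1) * g x + (- (M + 1) * 1 + 0).
  by apply/funext => x; rewrite /g; field; rewrite ?gt_eqF//; lra.
have b1 := bounded_measurable_cst 1; have b0 := bounded_measurable_cst 0.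
rewrite hE Phi_affine//; last exact: bounded_measurable_affine.
rewrite (Phi_affine (- (M + 1)) b1 b0) Phig Phi1.
have : Phi (fun=> 0) = 0.
  rewrite -[RHS](Phi0 _ measurable0); congr Phi; apply/funext => x.
  by rewrite indic0.
by move=> ->; lra.
Qed.

End functional.
End bounded_functions.

(** * Kernels acting on increasing functions *)

Section kernel_operator.
Context d (T : measurableType d) (R : realType).
Implicit Types (k : R.-pker T ~> T) (h : T -> R).

(** The action of a kernel on functions. *)
Definition kint k h (x : T) : R := \int[k x]_y h y.

Lemma kernel_le1 k x : (k x [set: T] <= 1)%E. Proof. by rewrite prob_kernel. Qed.

Lemma kint_cst k c x : kint k (fun=> c) x = c.
Proof. by rewrite /kint Rintegral_cst// prob_kernel mulr1. Qed.

Lemma kint_indic k (A : set T) x : measurable A -> kint k \1_A x = fine (k x A).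
Proof. by move=> mA; rewrite /kint (Rintegral_indic _ measurableT mA) setIT. Qed.

Lemma kint_affine k (c : R) f g x : bounded_measurable f -> bounded_measurable g ->
  kint k (fun y => c * f y + g y) x = c * kint k f x + kint k g x.
Proof. exact: (Rintegral_affine (kernel_le1 k x)). Qed.

Lemma norm_kint_le k h (M : R) x : bounded_measurable h ->
  (forall y, `|h y| <= M) -> `|kint k h x| <= M.
Proof. exact: (norm_Rintegral_le1 (kernel_le1 k x)). Qed.

Lemma bounded_measurable_kint k h :
  bounded_measurable h -> bounded_measurable (kint k h).
Proof.
move=> bh; have [mh [M hM]] := bh; split; last by exists M => x; exact: norm_kint_le.
pose g y := 1 * h y + M.
have bg : bounded_measurable g.
  by apply: bounded_measurable_affine => //; exact: bounded_measurable_cst.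
have g0 y : 0 <= g y by have := hM y; rewrite ler_norml /g => /andP[? ?]; lra.
have -> : kint k h = fun x => kint k g x - M.
  apply/funext => x; rewrite kint_affine//; last exact: bounded_measurable_cst.
  by rewrite kint_cst mul1r addrK.
apply: measurable_funB => //; apply: measurableT_comp => //.
apply: measurable_fun_integral_kernel => //.
- by move=> U mU; exact: measurable_kernel.
- by apply/measurable_EFinP; exact: bg.1.
Qed.

(** Both sides are bounded linear functionals of [h] that agree on indicators. *)
Lemma Rintegral_disintegration k (mu nu : {measure set T -> \bar R}) h :
  (mu [set: T] <= 1)%E -> (nu [set: T] <= 1)%E ->
  (forall B, measurable B -> nu B = (\int[mu]_x k x B)%E) ->
  bounded_measurable h -> \int[nu]_x h x = \int[mu]_x kint k h x.
Proof.
move=> mu1 nu1 nuE bh; apply/eqP; rewrite -subr_eq0; apply/eqP.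
pose Phi f := \int[nu]_x f x - \int[mu]_x kint k f x.
have fin_k x B : measurable B -> k x B \is a fin_num.
  move=> mB; rewrite ge0_fin_numE// (@le_lt_trans _ _ 1%E) ?ltry//.
  by apply: le_trans (kernel_le1 k x); apply: le_measure; rewrite ?inE.
apply: (@functional_indic_eq0 _ _ _ Phi 2) => //.
- move=> c f g bf bg; rewrite /Phi (Rintegral_affine nu1)//.
  under [X in _ - X = _]eq_Rintegral do rewrite kint_affine//.
  rewrite (Rintegral_affine mu1)//; [ring|exact: bounded_measurable_kint..].
- move=> f M bf fM; rewrite mulrDl mul1r /Phi (le_trans (ler_normB _ _))// lerD//.
    exact: norm_Rintegral_le1.
  apply: norm_Rintegral_le1 => //; first exact: bounded_measurable_kint.
  by move=> x; exact: norm_kint_le.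
- move=> B mB; rewrite /Phi Rintegral_indic// setIT nuE//.
  rewrite [X in _ - X](_ : _ = fine (\int[mu]_x k x B)) ?subrr//.
  congr fine; apply: eq_integral => x _; rewrite kint_indic//.
  by rewrite fineK// fin_k.
Qed.

End kernel_operator.

Section increasing.
Context d (S : POrderedPointedTopological.type d) (R : realType) (a b : S).
Hypothesis a_min : forall x : S, (a <= x)%O.
Hypothesis b_max : forall x : S, (x <= b)%O.
Implicit Types (h : S -> R) (k : R.-pker (borel S) ~> (borel S))
  (phi psi : probability (borel S) R).

Lemma ib_bounded_measurable h : ib h -> @bounded_measurable _ (borel S) R h.
Proof. by move=> [mh bh _]; split. Qed.

Lemma ib_cst (c : R) : ib (fun _ : S => c).
Proof. by split => //; exists `|c|. Qed.

Lemma ib_affine (c e : R) h : 0 <= c -> ib h -> ib (fun x => c * h x + e).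
Proof.
move=> c0 ibh; have [mh' bh'] := bounded_measurable_affine c
  (ib_bounded_measurable ibh) (bounded_measurable_cst (borel S) e).
split => // x y xy; rewrite lerD2r ler_wpM2l//.
by case: ibh => _ _; exact.
Qed.

Lemma ib_indic U : borel_upset U -> ib (\1_U : S -> R).
Proof.
move=> [mU uU]; have [? ?] := bounded_measurable_indic R mU; split => // x y xy.
rewrite !indicE ler_nat; case: (boolP (x \in U)) => // /set_mem Ux.
by rewrite mem_set//; exact: uU Ux.
Qed.

Lemma ib_kint k h : increasing_kernel k -> ib h -> ib (kint k h).
Proof.
move=> ik ibh.
have [mk bk] := bounded_measurable_kint k (ib_bounded_measurable ibh).
by split => // x y /ik; exact.
Qed.

Lemma ib_range h x : ib h -> h a <= h x <= h b.
Proof. by move=> [_ _ ih]; rewrite !ih. Qed.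

Lemma Rintegral_ib_range (mu : {measure set (borel S) -> \bar R}) h :
  mu [set: borel S] = 1%E -> ib h -> h a <= \int[mu]_x h x <= h b.
Proof.
move=> mu1 ibh; have le1 : (mu [set: borel S] <= 1)%E by rewrite mu1.
have int f : @bounded_measurable _ (borel S) R f ->
  mu.-integrable [set: borel S] (EFin \o f) by apply: bounded_measurable_integrable.
have cst c : \int[mu]_(x in [set: borel S]) c = c.
  by rewrite Rintegral_cst// mu1 mulr1.
have bh := ib_bounded_measurable ibh.
rewrite -(cst (h a)) -(cst (h b)); apply/andP; split; apply: le_Rintegral => //.
- by apply: int; exact: bounded_measurable_cst.
- exact: int.
- by move=> x _; case/andP: (ib_range x ibh).
- exact: int.
- by apply: int; exact: bounded_measurable_cst.
- by move=> x _; case/andP: (ib_range x ibh).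
Qed.

Lemma kint_ib_range k h x : ib h -> h a <= kint k h x <= h b.
Proof. by apply: Rintegral_ib_range; exact: prob_kernel. Qed.

Lemma Rintegral_ib_osc phi psi h : ib h ->
  `|\int[phi]_x h x - \int[psi]_x h x| <= h b - h a.
Proof.
move=> ibh; have := Rintegral_ib_range (probability_setT phi) ibh.
have := Rintegral_ib_range (probability_setT psi) ibh.
by move=> /andP[? ?] /andP[? ?]; rewrite ler_norml; apply/andP; split; lra.
Qed.

Lemma kint_act phi k h : ib h ->
  \int[act phi k]_x h x = \int[phi]_x kint k h x.
Proof.
move=> /ib_bounded_measurable bh; apply: Rintegral_disintegration => //.
- by rewrite [X in (X <= _)%E](_ : _ = 1%E)//; exact: probability_setT.
- by rewrite [X in (X <= _)%E](_ : _ = 1%E)//; exact: probability_setT.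
Qed.

(** The superlevel sets of an increasing function are up-sets. *)
Lemma upset_dist_ib phi psi (c : R) h :
  (forall U, borel_upset U -> `|fine (phi U) - fine (psi U)| <= c) ->
  ib h -> (forall x, 0 <= h x <= 1) ->
  `|\int[phi]_x h x - \int[psi]_x h x| <= c.
Proof.
move=> upc [mh bh ih] h01.
have le1 (m : probability (borel S) R) : (m [set: borel S] <= 1)%E.
  by rewrite [X in (X <= _)%E](_ : _ = 1%E)//; exact: probability_setT.
pose Phi (f : borel S -> R) := \int[phi]_x f x - \int[psi]_x f x.
apply: (@functional_superlevel_le _ _ _ Phi 2) => //.
- by move=> e f g bf bg; rewrite /Phi (Rintegral_affine (le1 phi))// (Rintegral_affine (le1 psi))//; ring.
- move=> f M bf fM; rewrite mulrDl mul1r /Phi (le_trans (ler_normB _ _))// lerD//.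
    exact: (norm_Rintegral_le1 (le1 phi)).
  exact: (norm_Rintegral_le1 (le1 psi)).
- move=> s; have ms := measurable_superlevel s mh.
  rewrite /Phi !Rintegral_indic// !setIT; apply: upc; split => //.
  by move=> x y xy /= sx; exact: le_trans (ih _ _ xy).
Qed.

Lemma bhattacharya_le phi psi (c : R) :
  (forall h, ib h -> (forall x, `|h x| <= 1) ->
    `|\int[phi]_x h x - \int[psi]_x h x| <= c) -> bhattacharya phi psi <= c.
Proof.
move=> hc; apply: sup_le_ub => [|_ [h [ibh h1 ->]]]; last exact: hc.
exists `|\int[phi]_x (fun=> 0) x - \int[psi]_x (fun=> 0) x|.
by exists (fun=> 0); split => //; [exact: ib_cst|rewrite normr0].
Qed.

Lemma ib_dist_le_bhattacharya phi psi h : ib h -> (forall x, `|h x| <= 1) ->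
  `|\int[phi]_x h x - \int[psi]_x h x| <= bhattacharya phi psi.
Proof.
move=> ibh h1; apply: ub_le_sup; last by exists h.
exists 2 => _ [g [ibg g1 ->]]; apply: (le_trans (Rintegral_ib_osc _ _ ibg)).
by have := g1 a; have := g1 b; rewrite !ler_norml => /andP[? ?] /andP[? ?]; lra.
Qed.

Lemma bhattacharya_ge0 phi psi : 0 <= bhattacharya phi psi.
Proof.
have h1 (x : S) : `|0 : R| <= 1 by rewrite normr0.
by apply: le_trans (ib_dist_le_bhattacharya phi psi (ib_cst 0) h1).
Qed.

End increasing.

(** * Contraction of oscillations and global stability *)

Section contraction.
Context d (S : POrderedPointedTopological.type d) (R : realType) (a b : S).
Hypothesis a_min : forall x : S, (a <= x)%O.
Hypothesis b_max : forall x : S, (x <= b)%O.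
Hypothesis order_near : forall x y : S, ~ (x <= y)%O ->
  \forall x' \near x & y' \near y, ~ (x' <= y')%O.
Implicit Types (h : S -> R) (k : R.-pker (borel S) ~> (borel S)).

Lemma measurable_ge (x : S) : @measurable _ (borel S) [set y : S | (x <= y)%O].
Proof.
rewrite [X in measurable X](_ : _ = up [set x]).
  by apply: closed_borel; apply: compact_closed_up order_near _ _; exact: compact_set1.
by apply/seteqP; split=> [y xy|y [_ ->]//]; exists x.
Qed.

Lemma measurable_le (x : S) : @measurable _ (borel S) [set y : S | (y <= x)%O].
Proof.
rewrite [X in measurable X](_ : _ = down [set x]).
  by apply: closed_borel; apply: compact_closed_down order_near _ _; exact: compact_set1.
by apply/seteqP; split=> [y xy|y [_ ->]//]; exists x.
Qed.

(** From [b], mass [eps] at least lands where [h <= h z]; from [a], mass [eps] at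
    least lands where [h >= h z]. *)
Lemma kint_mixing k eps h : monotone_mixing a b k eps -> ib h ->
  kint k h b - kint k h a <= (1 - eps) * (h b - h a).
Proof.
move=> [eps0 [z [az bz]]] ibh; have bh := ib_bounded_measurable ibh.
have [_ _ ih] := ibh.
have le_kint x f g : @bounded_measurable _ (borel S) R f ->
    @bounded_measurable _ (borel S) R g -> (forall y, f y <= g y) ->
    kint k f x <= kint k g x.
  move=> bf bg fg; apply: le_Rintegral => //;
    exact: (bounded_measurable_integrable (kernel_le1 k x)).
have epsE x (A : set (borel S)) : measurable A -> (eps%:E <= k x A)%E ->
    eps <= fine (k x A).
  move=> mA; rewrite -lee_fin => /le_trans; apply; rewrite fineK//.
  rewrite ge0_fin_numE// (@le_lt_trans _ _ 1%E) ?ltry//.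
  by apply: le_trans (kernel_le1 k x); apply: le_measure; rewrite ?inE.
pose U := [set y : S | (z <= y)%O]; pose D := [set y : S | (y <= z)%O].
have mU := measurable_ge z; have mD := measurable_le z.
have bU := bounded_measurable_indic R mU; have bD := bounded_measurable_indic R mD.
have cst c := bounded_measurable_cst (borel S) (c : R).
have lea : h a + (h z - h a) * eps <= kint k h a.
  apply: (@le_trans _ _ (kint k (fun y => (h z - h a) * \1_U y + h a) a)).
    rewrite kint_affine// kint_cst kint_indic// addrC lerD2r ler_wpM2l//.
      by rewrite subr_ge0 ih.
    exact: epsE.
  apply: le_kint => //; first exact: bounded_measurable_affine.
  move=> y; rewrite indicE; case: (boolP (y \in U)) => [/set_mem zy|_].
    by rewrite mulr1 subrK ih.
  by rewrite mulr0 add0r ih.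
have leb : kint k h b <= h b - (h b - h z) * eps.
  apply: (@le_trans _ _ (kint k (fun y => (h z - h b) * \1_D y + h b) b)).
    apply: le_kint => //; first exact: bounded_measurable_affine.
    move=> y; rewrite indicE; case: (boolP (y \in D)) => [/set_mem yz|_].
      by rewrite mulr1 subrK ih.
    by rewrite mulr0 add0r ih.
  rewrite kint_affine// kint_cst kint_indic// addrC lerD2l -mulNr opprB.
  by rewrite ler_wnM2l// ?subr_le0 ?ih//; exact: epsE.
by move: lea leb; lra.
Qed.

Lemma mixing_le1 k eps : monotone_mixing a b k eps -> eps <= 1.
Proof.
move=> [_ [z [az _]]]; rewrite -lee_fin (le_trans az)//.
apply: le_trans (kernel_le1 k a); apply: le_measure; rewrite ?inE//.
exact: measurable_ge.
Qed.

Lemma mixing_le k eps e : 0 < e -> e <= eps ->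
  monotone_mixing a b k eps -> monotone_mixing a b k e.
Proof.
move=> e0 le_e [_ [z [az bz]]]; split => //; exists z.
by split; [apply: le_trans az|apply: le_trans bz]; rewrite lee_fin.
Qed.

End contraction.

Section semigroup.
Context d (S : POrderedPointedTopological.type d) (R : realType) (a b : S).
Hypothesis a_min : forall x : S, (a <= x)%O.
Hypothesis b_max : forall x : S, (x <= b)%O.
Hypothesis order_near : forall x y : S, ~ (x <= y)%O ->
  \forall x' \near x & y' \near y, ~ (x' <= y')%O.
Variables (Time : set R) (P : R -> R.-pker (borel S) ~> (borel S)) (u eps : R).
Hypothesis TimeE : Time = nonneg_reals \/ Time = nonneg_integers.
Hypothesis tP : transition_function Time P.
Hypothesis iP : increasing_transition Time P.
Hypotheses (Tu : Time u) (u0 : 0 < u).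
Hypothesis mixP : monotone_mixing a b (P u) eps.
Implicit Types (h : S -> R) (phi psi : probability (borel S) R).

Lemma Time0 : Time 0.
Proof. by case: TimeE => ->; [exact: lexx|exists 0%N]. Qed.

Lemma TimeD s t : Time s -> Time t -> Time (s + t).
Proof.
case: TimeE => ->; first by rewrite /nonneg_reals /=; lra.
by move=> [m _ <-] [n _ <-]; exists (m + n)%N => //; rewrite natrD.
Qed.

Lemma Time_sub s t : Time s -> Time t -> s <= t -> Time (t - s).
Proof.
case: TimeE => ->; first by rewrite /nonneg_reals /=; lra.
move=> [m _ <-] [n _ <-]; rewrite ler_nat => mn.
by exists (n - m)%N => //; rewrite natrB.
Qed.

Lemma Time_natmul n : Time (n%:R * u).
Proof.
elim: n => [|n IH]; first by rewrite mul0r; exact: Time0.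
by rewrite -natr1 mulrDl mul1r; exact: TimeD.
Qed.

Lemma Time_ge0 t : Time t -> 0 <= t.
Proof. by case: TimeE => -> // -[n _ <-]. Qed.

Lemma kint_transitionD s t h : Time s -> Time t -> ib h ->
  kint (P (s + t)) h = kint (P s) (kint (P t) h).
Proof.
move=> Ts Tt ibh; apply/funext => x.
apply: Rintegral_disintegration; try exact: kernel_le1.
  by move=> B mB; exact: tP.2.
exact: ib_bounded_measurable.
Qed.

Lemma kint_transition0 h : ib h -> kint (P 0) h = h.
Proof.
move=> /ib_bounded_measurable bh; apply/funext => x.
have [mh _] := bh.
transitivity (\int[\d_(x : borel S)]_y h y).
  congr fine; apply: eq_measure_integral => A mA _.
  exact: tP.1.
by rewrite /Rintegral integral_dirac ?diracT ?mul1e//; exact/measurable_EFinP.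
Qed.

Lemma ib_transition t h : Time t -> ib h -> ib (kint (P t) h).
Proof. by move=> Tt; apply: ib_kint; exact: iP. Qed.

Lemma osc_transition t h : Time t -> ib h ->
  kint (P t) h b - kint (P t) h a <= h b - h a.
Proof.
move=> Tt ibh; have /andP[? ?] := kint_ib_range a_min b_max (P t) a ibh.
by have /andP[? ?] := kint_ib_range a_min b_max (P t) b ibh; lra.
Qed.

Let eps01 : 0 <= 1 - eps <= 1.
Proof.
have := mixing_le1 order_near mixP; have [? _] := mixP.
by move=> ?; apply/andP; split; lra.
Qed.

(** One factor [1 - eps] for each multiple of [u] that fits in [t]; the remaining
    time does not increase the oscillation. *)
Lemma osc_geometric n t h : Time t -> n%:R * u <= t -> ib h ->
  kint (P t) h b - kint (P t) h a <= (1 - eps) ^+ n * (h b - h a).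
Proof.
elim: n t => [|n IH] t Tt nt ibh.
  by rewrite expr0 mul1r; exact: osc_transition.
have ut : u <= t.
  by apply: le_trans nt; rewrite ler_peMl ?ler1n// ltW.
have Tr : Time (t - u) by exact: Time_sub.
rewrite -(subrKC u t) kint_transitionD//; have ibg := ib_transition Tr ibh.
apply: (le_trans (kint_mixing a_min b_max order_near mixP ibg)).
rewrite exprS -mulrA; apply: ler_wpM2l; first by case/andP: eps01.
by apply: IH => //; move: nt; rewrite -natr1 mulrDl mul1r; lra.
Qed.

(** The integer part [n] of [t / u] satisfies [n + 1 >= t / u], so trading [n] for
    [t / u] in the geometric bound costs one factor [(1 - eps)^-1]. *)
Lemma osc_exponential t h : eps < 1 -> Time t -> ib h ->
  kint (P t) h b - kint (P t) h a <=
  (1 - eps)^-1 * expR (- (ln (1 / (1 - eps)) / u) * t) * (h b - h a).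
Proof.
move=> eps1 Tt ibh; have t0 := Time_ge0 Tt.
have tu0 : 0 <= t / u by rewrite divr_ge0// ltW.
have /andP[nt tn] := truncn_itv tu0; set n := Num.truncn _ in nt tn.
have q0 : 0 < 1 - eps by lra.
have osc0 : 0 <= h b - h a by case: ibh => _ _ ih; rewrite subr_ge0 ih.
apply: (le_trans (osc_geometric (n := n) Tt _ ibh)).
  by rewrite -ler_pdivlMr.
apply: ler_wpM2r => //.
rewrite ler_pdivlMl// -exprS -{1}(lnK (x := 1 - eps)) ?posrE// -expRM_natl ler_expR.
rewrite div1r lnV ?posrE// !mulNr opprK -mulrA [u^-1 * t]mulrC [leRHS]mulrC.
apply: ler_wnM2r; last exact: ltW.
by apply: ln_le0; case: mixP; lra.
Qed.

Lemma dist_act_osc phi psi t h : Time t -> ib h ->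
  `|\int[act phi (P t)]_x h x - \int[act psi (P t)]_x h x| <=
  kint (P t) h b - kint (P t) h a.
Proof.
by move=> Tt ibh; rewrite !kint_act//; apply: Rintegral_ib_osc => //; exact: ib_transition.
Qed.

Lemma stationary_Rintegral phi t h : Time t -> ib h -> stationary Time P phi ->
  \int[act phi (P t)]_x h x = \int[phi]_x h x.
Proof.
move=> Tt ibh sphi; congr fine; apply: eq_measure_integral => A mA _; exact: sphi.
Qed.

Lemma bhattacharya_exponential phi phistar t : eps < 1 -> Time t ->
  stationary Time P phistar ->
  bhattacharya (act phi (P t)) phistar <=
    2 / (1 - eps) * expR (- (ln (1 / (1 - eps)) / u) * t).
Proof.
move=> eps1 Tt sphi; apply: bhattacharya_le => h ibh h1.
rewrite -(stationary_Rintegral Tt ibh sphi).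
apply: (le_trans (dist_act_osc _ _ Tt ibh)).
apply: (le_trans (osc_exponential eps1 Tt ibh)).
have osc2 : h b - h a <= 2.
  by have := h1 a; have := h1 b; rewrite !ler_norml => /andP[? ?] /andP[? ?]; lra.
set e := expR _; rewrite -mulrA mulrCA [2 / _]mulrC -mulrA.
rewrite mulrCA ler_wpM2l ?invr_ge0 ?subr_ge0 ?(ltW eps1)//.
by rewrite mulrC ler_wpM2r ?expR_ge0.
Qed.

Lemma bhattacharya_geometric phi phistar n t : Time t -> n%:R * u <= t ->
  stationary Time P phistar ->
  bhattacharya (act phi (P t)) phistar <= (1 - eps) ^+ n * 2.
Proof.
move=> Tt nt sphi; apply: bhattacharya_le => h ibh h1.
rewrite -(stationary_Rintegral Tt ibh sphi).
apply: (le_trans (dist_act_osc _ _ Tt ibh)).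
apply: (le_trans (osc_geometric Tt nt ibh)); case/andP: eps01 => e0 _.
rewrite ler_wpM2l ?exprn_ge0//.
by have := h1 a; have := h1 b; rewrite !ler_norml => /andP[? ?] /andP[? ?]; lra.
Qed.

Lemma cvg_geometric_mixing : (1 - eps) ^+ n @[n --> \oo] --> 0.
Proof.
apply: cvg_expr; case/andP: eps01 => e0 _; rewrite ger0_norm//.
by case: mixP; lra.
Qed.

Lemma bhattacharya_cvg phi phistar : stationary Time P phistar ->
  bhattacharya (act phi (P t)) phistar
    @[t --> within Time (pinfty_nbhs R)] --> 0.
Proof.
move=> sphi; apply/cvgr0Pnorm_lt => e e0.
have e20 : 0 < e / 2 by rewrite divr_gt0.
have := cvgr_lt _ cvg_geometric_mixing _ e20.
move=> [n _ /(_ n (leqnn n)) /= ne].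
exists (n%:R * u); split; first exact: num_real.
move=> t nt Tt; rewrite ger0_norm ?(bhattacharya_ge0 a_min b_max)//.
rewrite (le_lt_trans (bhattacharya_geometric _ Tt (ltW nt) sphi))//.
by move: ne; rewrite ltr_pdivlMr.
Qed.

Section existence.
Variables (J : countType) (B : J -> set S).
Hypothesis cS : compact [set: S].
Hypothesis basisB : closed_basis B.

(** [updiff] is stable under intersections and generates the Borel sets. *)
Lemma eq_borel_upset phi psi :
  (forall U, borel_upset U -> fine (phi U) = fine (psi U)) ->
  forall A : set (borel S), measurable A -> phi A = psi A.
Proof.
move=> eqU; have fin (m : probability (borel S) R) U : borel_upset U ->
  m U \is a fin_num by move=> [mU _]; exact: fin_num_measure.
have eqU' U : borel_upset U -> phi U = psi U.
  by move=> bU; rewrite -(fineK (fin phi U bU)) eqU// fineK// fin.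
move=> A mA; apply: (@measure_unique _ R (borel S) (@updiff d S) (fun=> setT)) => //.
- apply/seteqP; split.
    apply: smallest_sub; first exact: smallest_sigma_algebra.
    exact: (open_sub_updiff_sigma cS basisB order_near).
  by apply: smallest_sub; [exact: sigma_algebra_measurable|exact: updiff_borel].
- exact: updiffI.
- by move=> _; apply: updiff_upset; exact: borel_upsetT.
- by rewrite bigcup_const.
- move=> _ [U [V [uU uV VU ->]]]; have [[mU _] [mV _]] := (uU, uV).
  rewrite !measureD//.
  + by rewrite (setIidr VU); congr (_ - _)%E; exact: eqU'.
  + by rewrite (le_lt_trans (probability_le1 psi mU))// ltry.
  + by rewrite (le_lt_trans (probability_le1 phi mU))// ltry.
- by move=> _; rewrite (le_lt_trans (probability_le1 _ measurableT))// ltry.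
Qed.

Lemma indic_range (U : set S) x : 0 <= (\1_U x : R) <= 1.
Proof. by rewrite indicE; case: (_ \in _); rewrite /= ?lexx ?ler01. Qed.

Lemma fine_Rintegral_indic phi U : borel_upset U ->
  fine (phi U) = \int[phi]_x \1_U x.
Proof. by move=> [mU _]; rewrite Rintegral_indic// setIT. Qed.

Lemma osc_indic_le1 n t U : Time t -> n%:R * u <= t -> borel_upset U ->
  kint (P t) \1_U b - kint (P t) \1_U a <= (1 - eps) ^+ n.
Proof.
move=> Tt nt bU; apply: (le_trans (osc_geometric Tt nt (ib_indic R bU))).
case/andP: eps01 => e0 _; have /andP[? ?] := indic_range U a.
have /andP[? ?] := indic_range U b.
have le1 : \1_U b - \1_U a <= 1 :> R by lra.
by rewrite -[leRHS]mulr1; apply: ler_wpM2l le1; exact: exprn_ge0.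
Qed.

Lemma stationary_unique phi psi : stationary Time P phi -> stationary Time P psi ->
  forall A : set (borel S), measurable A -> phi A = psi A.
Proof.
move=> sphi spsi; apply: eq_borel_upset => U bU; have ibU := ib_indic R bU.
apply/eqP; rewrite -subr_eq0 -normr_eq0; apply/eqP/le_anti.
rewrite normr_ge0 andbT; apply: (cvgr_to_ge cvg_geometric_mixing).
apply: nearW => n; have Tn := Time_natmul n.
rewrite !fine_Rintegral_indic// -(stationary_Rintegral Tn ibU sphi).
rewrite -(stationary_Rintegral Tn ibU spsi).
apply: (le_trans (dist_act_osc _ _ Tn ibU)).
by apply: osc_indic_le1.
Qed.

(** The limit [phi] of the laws [m n = delta_a P_(n u)].  With [g = P_t 1_U], the
    difference between [phi P_t] and [phi] on [U] is at most the sum of the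
    distances from [phi] to [m n] on [g] and on [1_U], and of the distance
    between [m n P_t] and [m n] on [U]; each is at most [(1 - eps) ^+ n]. *)
Lemma stationary_exists : exists phistar, stationary Time P phistar.
Proof.
pose m n : probability (borel S) R := act (dirac (a : borel S)) (P (n%:R * u)).
have mE n h : ib h -> \int[m n]_x h x = kint (P (n%:R * u)) h a.
  move=> ibh; have ibk := ib_transition (Time_natmul n) ibh.
  rewrite kint_act// /Rintegral integral_dirac ?diracT ?mul1e//.
  by apply/measurable_EFinP; case: ibk.
have close (k : R.-pker (borel S) ~> (borel S)) (g : S -> R) : ib g -> `|kint k g a - g a| <= g b - g a.
  move=> ibg; have /andP[? ?] := kint_ib_range a_min b_max k a ibg.
  by rewrite ler_norml; apply/andP; split; lra.
have m_cauchy n k U : (n <= k)%N -> borel_upset U ->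
    `|fine (m n U) - fine (m k U)| <= (1 - eps) ^+ n.
  move=> nk bU; have ibU := ib_indic R bU.
  rewrite !fine_Rintegral_indic// !mE// distrC.
  have Tn := Time_natmul n; have Tkn := Time_natmul (k - n).
  rewrite -(subnK nk) natrD mulrDl kint_transitionD//.
  apply: (le_trans (close _ _ (ib_transition Tn ibU))).
  exact: osc_indic_le1.
have [phi mphi] := upset_cauchy_limit cS basisB order_near cvg_geometric_mixing m_cauchy.
have mphi_ib n h : ib h -> (forall x, 0 <= h x <= 1) ->
    `|kint (P (n%:R * u)) h a - \int[phi]_x h x| <= (1 - eps) ^+ n.
  by move=> ibh h01; rewrite -mE//; apply: upset_dist_ib => // U bU; exact: mphi.
exists phi => t Tt; apply: eq_borel_upset => U bU; have ibU := ib_indic R bU.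
have ibg := ib_transition Tt ibU.
apply/eqP; rewrite -subr_eq0 -normr_eq0; apply/eqP/le_anti.
rewrite normr_ge0 andbT.
have cv : (3 : R) * (1 - eps) ^+ n @[n --> \oo] --> (3 * 0 : R).
  by apply: cvgMr; exact: cvg_geometric_mixing.
rewrite -[leRHS](mulr0 (3 : R)); apply: (cvgr_to_ge cv); apply: nearW => n.
have Tn := Time_natmul n.
rewrite !fine_Rintegral_indic// kint_act//.
have g01 x : 0 <= kint (P t) \1_U x <= 1.
  have /andP[? ?] := kint_ib_range a_min b_max (P t) x ibU.
  have /andP[? ?] := indic_range U a; have /andP[? ?] := indic_range U b.
  by apply/andP; split; lra.
have := mphi_ib n _ ibg g01; have := mphi_ib n _ ibU (indic_range U).
have := close (P t) _ (ib_transition Tn ibU).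
rewrite -!kint_transitionD// [n%:R * u + t]addrC.
have := osc_indic_le1 Tn (lexx _) bU.
by rewrite !ler_norml => ? /andP[? ?] /andP[? ?] /andP[? ?]; apply/andP; split; lra.
Qed.

Theorem mixing_globally_stable : globally_stable Time P.
Proof.
have [phi sphi] := stationary_exists; exists phi; split => //.
- by move=> psi spsi A mA; exact: stationary_unique.
- by move=> psi; exact: bhattacharya_cvg.
Qed.

End existence.
End semigroup.

(** * A strong law from second moments *)

(** Between two consecutive squares [s] varies by at most [2 (k + 1) M], which is
    negligible against [(k + 1) ^ 2]. *)
Lemma cvg_average_squares (R : realType) (s : nat -> R) (M : R) :
  (forall n, `|s n.+1 - s n| <= M) ->
  (((k.+1 ^ 2)%N%:R)^-1 * s (k.+1 ^ 2)%N) @[k --> \oo] --> 0 ->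
  (n%:R^-1 * s n) @[n --> \oo] --> 0.
Proof.
move=> sM cvs; have M0 : 0 <= M by rewrite (le_trans _ (sM 0%N)).
have incr n m : `|s (n + m)%N - s n| <= m%:R * M.
  elim: m => [|m IH]; first by rewrite addn0 subrr normr0 mul0r.
  rewrite addnS (_ : _ - _ = (s (n + m).+1 - s (n + m)%N) + (s (n + m)%N - s n)).
    by rewrite (le_trans (ler_normD _ _))// -natr1 mulrDl mul1r addrC lerD.
  by rewrite addrA subrK.
have sqr n : (0 < n)%N -> exists k, (k.+1 ^ 2 <= n < k.+2 ^ 2)%N.
  elim: n => // -[_ _|n /(_ isT)[k /andP[kn nk]] _]; first by exists 0%N.
  have [lt|ge] := ltnP n.+2 (k.+2 ^ 2); first by exists k; rewrite lt andbT leqW.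
  by exists k.+1; rewrite ge/= (leq_ltn_trans nk)// ltn_exp2r.
apply/cvgr0Pnorm_lt => e e0.
have e20 : 0 < e / 2 by rewrite divr_gt0.
have [N1 _ N1e] := (cvgr0Pnorm_lt _).1 cvs _ e20.
have cvM : 2 * M * k.+1%:R^-1 @[k --> \oo] --> (2 * M * 0 : R).
  by apply: cvgMr; exact: cvg_harmonic.
rewrite mulr0 in cvM.
have := cvgr_lt _ cvM _ e20; move=> [N2 _ N2e].
exists ((maxn N1 N2).+1 ^ 2)%N => // n /= Nn.
have n0 : (0 < n)%N by apply: leq_trans Nn; rewrite expn_gt0.
have [k /andP[kn nk]] := sqr n n0.
have Nk : (maxn N1 N2 <= k)%N.
  have : ((maxn N1 N2).+1 ^ 2 < k.+2 ^ 2)%N by exact: leq_ltn_trans nk.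
  by rewrite ltn_exp2r.
have := N1e k (leq_trans (leq_maxl _ _) Nk); have := N2e k (leq_trans (leq_maxr _ _) Nk).
move=> /= le2 le1; rewrite (splitr e).
have k0 : 0 < (k.+1 ^ 2)%N%:R :> R by rewrite ltr0n expn_gt0.
have n0' : 0 < n%:R :> R by rewrite ltr0n.
apply: (@le_lt_trans _ _ (`|((k.+1 ^ 2)%N%:R)^-1 * s (k.+1 ^ 2)%N| + 2 * M * k.+1%:R^-1)); last first.
  by rewrite ltrD.
have sn : `|s n| <= `|s (k.+1 ^ 2)%N| + (2 * k.+1)%:R * M.
  have := incr (k.+1 ^ 2)%N (n - k.+1 ^ 2)%N; rewrite subnKC// => le_sn.
  rewrite -[s n](subrK (s (k.+1 ^ 2)%N)) addrC (le_trans (ler_normD _ _))//.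
  rewrite lerD2l (le_trans le_sn)// ler_wpM2r// ler_nat.
  by rewrite leq_subLR; move: nk; nia.
have inv0 m : `|m%:R^-1| = m%:R^-1 :> R by rewrite ger0_norm// invr_ge0.
rewrite !normrM !inv0.
apply: (@le_trans _ _ (((k.+1 ^ 2)%N%:R)^-1 * `|s n|)).
  by rewrite ler_wpM2r// lef_pV2 ?posrE// ler_nat.
apply: (@le_trans _ _ (((k.+1 ^ 2)%N%:R)^-1 * (`|s (k.+1 ^ 2)%N| + (2 * k.+1)%:R * M))).
  by rewrite ler_wpM2l// invr_ge0 ltW.
rewrite mulrDr lerD2l natrX natrM le_eqVlt; apply/orP; left; apply/eqP.
by field; rewrite addrC natr1 pnatr_eq0.
Qed.

Lemma ae_probability1 d (T : measurableType d) (R : realType)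
    (Pr : probability T R) (A : set T) : measurable A ->
  {ae Pr, forall w, A w} -> Pr A = 1%E.
Proof.
move=> mA aeA; have nA : Pr (~` A) = 0%E.
  by apply/negligibleP => //; exact: measurableC.
have : (Pr (~` A) = 1 - Pr A)%E by rewrite probability_setC.
rewrite nA -(fineK (fin_num_measure Pr A mA)) -EFinB => -[/esym/eqP].
by rewrite subr_eq0 => /eqP <-.
Qed.

(** Convergence is a countable combination of measurable conditions. *)
Lemma measurable_cvg_set d (T : measurableType d) (R : realType)
    (u : nat -> T -> R) (l : R) : (forall n, measurable_fun setT (u n)) ->
  measurable [set w | u n w @[n --> \oo] --> l].
Proof.
move=> mu; rewrite (_ : [set _ | _] = \bigcap_m \bigcup_N \bigcap_(n in [set n | (N <= n)%N])
    [set w | `|l - u n w| < m.+1%:R^-1]).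
  apply: bigcapT_measurable => m; apply: bigcupT_measurable => N.
  apply: bigcap_measurableType => n _; rewrite -[X in measurable X]setTI.
  have -> : [set w | `|l - u n w| < m.+1%:R^-1] =
      (fun w => `|l - u n w|) @^-1` `]-oo, m.+1%:R^-1[.
    by apply/seteqP; split=> w /=; rewrite in_itv.
  have mf : measurable_fun setT (fun w => `|l - u n w|).
    by apply: measurableT_comp => //; exact: measurable_funB.
  by apply: mf => //; exact: measurable_itv.
apply/seteqP; split=> [w /= cw m _|w cw /=].
  have m0 : 0 < m.+1%:R^-1 :> R by rewrite invr_gt0.
  by have [N _ Nw] := (cvgrPdist_lt _ _).1 cw _ m0; exists N => // n /= Nn; exact: Nw.
apply/cvgrPdist_lt => e e0.
have [m _ /(_ m (leqnn m)) /= me] := near_infty_natSinv_lt (PosNum e0).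
have [N _ Nw] := cw m I; exists N => // n /= Nn.
by apply: lt_trans me; exact: Nw.
Qed.

Section second_moment.
Context d (T : measurableType d) (R : realType) (Pr : probability T R).
Variables (Y : nat -> T -> R) (M D : R).
Hypothesis bY : forall t, bounded_measurable (Y t).
Hypothesis YM : forall t w, `|Y t w| <= M.

Definition psum n w := \sum_(0 <= t < n) Y t w.

Hypothesis moment2 : forall n, \int[Pr]_w (psum n w ^+ 2) <= D * n%:R.

Lemma bounded_measurableM (f g : T -> R) :
  bounded_measurable f -> bounded_measurable g -> bounded_measurable (f \* g).
Proof.
move=> [mf [A fA]] [mg [B gB]]; split; first exact: measurable_funM.
by exists (A * B) => x; rewrite normrM ler_pM.
Qed.

Lemma bounded_measurable_psum n : bounded_measurable (psum n).
Proof.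
elim: n => [|n IH].
  rewrite (_ : psum 0 = fun=> 0); first exact: bounded_measurable_cst.
  by apply/funext => w; rewrite /psum big_geq.
rewrite (_ : psum n.+1 = fun w => 1 * psum n w + Y n w).
  exact: bounded_measurable_affine.
by apply/funext => w; rewrite /psum big_nat_recr//= mul1r.
Qed.

Let Z k w := (((k.+1 ^ 2)%N%:R)^-1 * psum (k.+1 ^ 2) w) ^+ 2.

Let bZ k : bounded_measurable (Z k).
Proof.
rewrite (_ : Z k = fun w => ((k.+1 ^ 2)%N%:R ^- 2) * (psum (k.+1 ^ 2) \* psum (k.+1 ^ 2)) w + 0).
  apply: bounded_measurable_affine; last exact: bounded_measurable_cst.
  by apply: bounded_measurableM; exact: bounded_measurable_psum.
by apply/funext => w; rewrite /Z exprMn exprVn addr0.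
Qed.

Let mean_Z k : \int[Pr]_w Z k w <= D * ((k.+1 ^ 2)%N%:R)^-1.
Proof.
rewrite /Z.
have le1 : (Pr [set: T] <= 1)%E by rewrite probability_setT.
have bp := bounded_measurable_psum (k.+1 ^ 2).
have bp2 := bounded_measurableM bp bp.
rewrite (_ : (fun _ => _) = fun w => ((k.+1 ^ 2)%N%:R ^- 2) *
   (psum (k.+1 ^ 2) w * psum (k.+1 ^ 2) w)); last first.
  by apply/funext => w; rewrite exprMn exprVn.
rewrite RintegralZl//; last exact: bounded_measurable_integrable bp2.
have k0 : 0 < (k.+1 ^ 2)%N%:R :> R by rewrite ltr0n expn_gt0.
apply: (@le_trans _ _ ((k.+1 ^ 2)%N%:R ^- 2 * (D * (k.+1 ^ 2)%N%:R))).
  by rewrite ler_wpM2l// ?invr_ge0 ?exprn_ge0 ?ler0n//; exact: moment2.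
rewrite le_eqVlt; apply/orP; left; apply/eqP; field.
by rewrite gt_eqF.
Qed.

Let D0 : 0 <= D.
Proof.
have := moment2 1; rewrite mulr1; apply: le_trans.
by apply: Rintegral_ge0 => w _; exact: sqr_ge0.
Qed.

Let sum_mean_Z n : \sum_(0 <= k < n) \int[Pr]_w Z k w <= 2 * D.
Proof.
(* Telescoping: [1 / (n + 1) ^ 2 <= 2 / (n + 1) - 2 / (n + 2)]. *)
apply: (@le_trans _ _ (2 * D * (1 - n.+1%:R^-1))); last first.
  by rewrite ler_piMr ?mulr_ge0// lerBlDr lerDl invr_ge0.
elim: n => [|n IH]; first by rewrite big_geq// invr1 subrr mulr0.
rewrite big_nat_recr//= (le_trans (lerD IH (mean_Z n)))//.
rewrite -subr_ge0 [X in 0 <= X](_ : _ = D * (n%:R / (n.+1%:R ^+ 2 * n.+2%:R))).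
  by rewrite mulr_ge0// divr_ge0// mulr_ge0.
rewrite natrX -[n.+2%:R]natr1 -[n.+1%:R]natr1.
have n0 : 0 <= n%:R :> R by [].
by field; apply/andP; split; apply: lt0r_neq0; lra.
Qed.

(** The squares of the averages along [(k + 1) ^ 2] have summable means, so almost
    surely they are summable and tend to 0. *)
Theorem average_cvg0_ae : {ae Pr, forall w, n%:R^-1 * psum n w @[n --> \oo] --> 0}.
Proof.
have mZ k : measurable_fun [set: T] (EFin \o Z k).
  by apply/measurable_EFinP; case: (bZ k).
have Z0 k w : 0 <= Z k w by exact: sqr_ge0.
have le1 : (Pr [set: T] <= 1)%E by rewrite probability_setT.
have intZ k : (\int[Pr]_w (Z k w)%:E)%E = (\int[Pr]_w Z k w)%:E.
  rewrite /Rintegral fineK//; apply: integrable_fin_num => //.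
  exact: bounded_measurable_integrable.
(* The sum of the [Z k] has finite mean, hence is finite almost everywhere. *)
pose Zs w := (\sum_(k <oo) (Z k w)%:E)%E.
have mZs : measurable_fun [set: T] Zs.
  apply: (@ge0_emeasurable_sum _ _ _ setT (fun k w => (Z k w)%:E) xpredT) => //.
  - by move=> k w _ _; rewrite lee_fin.
  - by move=> k _; exact: mZ.
have fin_Zs : Pr.-integrable [set: T] Zs.
  apply/integrableP; split; first exact: mZs.
  have -> : (\int[Pr]_w `|Zs w| = \int[Pr]_w Zs w)%E.
    by apply: eq_integral => w _; rewrite gee0_abs// nneseries_ge0// => k _ _; rewrite lee_fin.
  rewrite integral_nneseries//; last by move=> k w _; rewrite lee_fin.
  apply: (@le_lt_trans _ _ (2 * D)%:E); last exact: ltry.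
  apply: lime_le.
    by apply: is_cvg_nneseries => k _ _; apply: integral_ge0 => w _; rewrite lee_fin.
  apply: nearW => n; under eq_bigr do rewrite intZ.
  by rewrite sumEFin lee_fin.
have := integrable_ae measurableT fin_Zs; apply: filterS => w /(_ I) finw.
apply: (@cvg_average_squares _ _ M).
  by move=> n; rewrite /psum big_nat_recr//= addrAC subrr add0r.
have cvZ : Z k w @[k --> \oo] --> 0.
  apply: cvg_series_cvg_0; apply: nondecreasing_is_cvgn.
    by apply/nondecreasing_seqP => n; rewrite /series/= big_nat_recr//= lerDl.
  exists (fine (Zs w)) => _ [n _ <-]; rewrite -lee_fin fineK// /series/=.
  rewrite -sumEFin; apply: nneseries_lim_ge => k _ _.
  by rewrite lee_fin.
apply/cvgr0Pnorm_lt => e e0.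
have [N _ NZ] := (cvgr_lt _ cvZ _ (exprn_gt0 2 e0)).
exists N => // k /NZ /=; rewrite /Z -[X in X < _]real_normK ?num_real//.
by rewrite ltr_pXn2r// nnegrE ltW.
Qed.

End second_moment.

(** * Decay of correlations for a Markov process *)

Section markov_chain.
Context d (S : POrderedPointedTopological.type d) (R : realType)
  dO (Omega : measurableType dO) (Pr : probability Omega R).
Variables (k : R.-pker (borel S) ~> (borel S)) (X : nat -> {RV Pr >-> borel S}).
Hypothesis mX : markov_process k X.
Implicit Types (F : set Omega) (g : S -> R).

Let Pr1 : (Pr [set: Omega] <= 1)%E. Proof. by rewrite probability_setT. Qed.

Lemma natural_filtration_measurable t F : natural_filtration X t F -> measurable F.
Proof.
apply: smallest_sub F; first exact: sigma_algebra_measurable.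
by move=> _ [i _ [B mB <-]]; exact: measurable_funP.
Qed.

Lemma natural_filtrationW s t F : (s <= t)%N ->
  natural_filtration X s F -> natural_filtration X t F.
Proof.
move=> st; apply: sub_smallest2r; first exact: smallest_sigma_algebra.
by move=> A [i /= i_s XA]; exists i => //=; exact: leq_trans st.
Qed.

Lemma natural_filtration_preimage t (B : set (borel S)) : measurable B ->
  natural_filtration X t (X t @^-1` B).
Proof.
move=> mB; apply: sub_sigma_algebra; exists t => //=.
by exists B => //; rewrite setTI.
Qed.

Lemma bounded_measurable_RV t g : @bounded_measurable _ (borel S) R g ->
  bounded_measurable (fun w => g (X t w)).
Proof.
move=> [mg [M gM]]; split; last by exists M => w; exact: gM.
exact: (measurableT_comp mg (measurable_funP (X t))).
Qed.

(** Both sides are bounded linear functionals of [g]; on indicators the identity is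
    the defining property of the conditional probability. *)
Lemma markov_step t F g : natural_filtration X t F ->
    @bounded_measurable _ (borel S) R g ->
  \int[Pr]_(w in F) g (X t.+1 w) = \int[Pr]_(w in F) kint k g (X t w).
Proof.
move=> FF bg; have mF := natural_filtration_measurable FF.
apply/eqP; rewrite -subr_eq0; apply/eqP.
pose Phi (f : borel S -> R) :=
  \int[Pr]_(w in F) f (X t.+1 w) - \int[Pr]_(w in F) kint k f (X t w).
apply: (@functional_indic_eq0 _ _ _ Phi 2) => //.
- move=> c f f' bf bf'; rewrite /Phi (Rintegral_affine Pr1)//; try exact: bounded_measurable_RV.
  under [X in _ - X = _]eq_Rintegral do rewrite kint_affine//.
  rewrite (Rintegral_affine Pr1)//; [ring| |];
    by apply: bounded_measurable_RV; exact: bounded_measurable_kint.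
- move=> f M bf fM; rewrite mulrDl mul1r /Phi (le_trans (ler_normB _ _))// lerD//;
    apply: norm_Rintegral_le1 => //.
  + exact: bounded_measurable_RV.
  + by apply: bounded_measurable_RV; exact: bounded_measurable_kint.
  + by move=> w; exact: norm_kint_le.
- move=> B mB; have [g' [intg' _ g'E] g'k] := mX t mB.
  have mXB i : measurable (X i @^-1` B) by apply: measurable_funPTI.
  rewrite /Phi (_ : (fun w => \1_B (X t.+1 w)) = \1_(X t.+1 @^-1` B))//.
  rewrite Rintegral_indic// [X in fine X - _](_ : _ = \int[Pr]_(w in F) g' w)%E; last first.
    exact/esym/g'E.
  rewrite /Rintegral; apply/eqP; rewrite subr_eq0; apply/eqP.
  congr fine; apply: ae_eq_integral => //.
  + by apply: measurable_funTS; case/integrableP: intg'.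
  + apply/measurable_EFinP/measurable_funTS.
    apply: (bounded_measurable_RV t _).1.
    by apply: bounded_measurable_kint; exact: bounded_measurable_indic.
  + apply: filterS g'k => w -> _; rewrite kint_indic// fineK//.
    rewrite ge0_fin_numE// (@le_lt_trans _ _ 1%E) ?ltry//.
    by apply: le_trans (kernel_le1 k (X t w)); apply: le_measure; rewrite ?inE.
Qed.

(** The [n]th iterate of [k] acting on functions, composed so that the last step of
    the chain is integrated first. *)
Fixpoint kiter n g : S -> R := if n is m.+1 then kiter m (kint k g) else g.

Lemma markov_steps n s F g : natural_filtration X s F ->
    @bounded_measurable _ (borel S) R g ->
  \int[Pr]_(w in F) g (X (s + n)%N w) = \int[Pr]_(w in F) kiter n g (X s w).
Proof.
move=> FF; elim: n g => [|n IH] g bg /=; first by rewrite addn0.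
rewrite addnS markov_step//; last exact: natural_filtrationW (leq_addr _ _) FF.
by rewrite IH//; exact: bounded_measurable_kint.
Qed.

Section decorrelation.
Variables (f : S -> R) (M K q : R).
Hypothesis bf : @bounded_measurable _ (borel S) R f.
Hypothesis M0 : 0 < M.
Hypothesis fM : forall x, `|f x| <= M.
Hypothesis K0 : 0 <= K.
Hypothesis q01 : 0 <= q < 1.
Hypothesis f_decay : forall n x, `|kiter n f x| <= K * q ^+ n.

Let bfX t : bounded_measurable (fun w => f (X t w)).
Proof. exact: bounded_measurable_RV. Qed.

(** After [n] steps the chain has almost forgotten any event of its past. *)
Let event_decay n s F : natural_filtration X s F ->
  `|\int[Pr]_(w in F) f (X (s + n)%N w)| <= K * q ^+ n.
Proof.
move=> FF; have mF := natural_filtration_measurable FF; rewrite markov_steps//.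
have bk m g : @bounded_measurable _ (borel S) R g ->
    @bounded_measurable _ (borel S) R (kiter m g).
  by elim: m g => // m IH g bg; apply: IH; exact: bounded_measurable_kint.
have b := bounded_measurable_RV s (bk n _ bf).
exact: (norm_Rintegral_le1 Pr1 mF b (fun w => f_decay n (X s w))).
Qed.

(** The bound for events extends to functions of [X s] with values in [[0, 1]].
    Writing [f = 2 * M * g - M] with [g] such a function gives the constant
    [2 * M + M]. *)
Lemma correlation_decay s n :
  `|\int[Pr]_w (f (X s w) * f (X (s + n)%N w))| <= 3 * M * (K * q ^+ n).
Proof.
pose Phi (g : borel S -> R) := \int[Pr]_w (g (X s w) * f (X (s + n)%N w)).
have bgf (g : borel S -> R) : bounded_measurable g ->
    bounded_measurable (fun w => g (X s w) * f (X (s + n)%N w)).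
  by move=> bg; apply: bounded_measurableM => //; exact: bounded_measurable_RV.
have Phi_affine (c : R) (g g' : borel S -> R) : bounded_measurable g ->
    bounded_measurable g' -> Phi (fun x => c * g x + g' x) = c * Phi g + Phi g'.
  move=> bg bg'; rewrite /Phi -(Rintegral_affine Pr1)//; try exact: bgf.
  by congr Rintegral; apply/funext => w; ring.
have Phi_bounded (g : borel S -> R) (A : R) : bounded_measurable g ->
    (forall x, `|g x| <= A) -> `|Phi g| <= M * A.
  move=> bg gA; have A0 : 0 <= A by rewrite (le_trans _ (gA point)).
  have le_MA w : `|g (X s w) * f (X (s + n)%N w)| <= M * A.
    by rewrite normrM mulrC ler_pM.
  exact: (norm_Rintegral_le1 Pr1 measurableT (bgf _ bg) le_MA).
have Phi_indic (A : set (borel S)) : measurable A -> `|Phi \1_A| <= K * q ^+ n.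
  move=> mA; rewrite /Phi; set F := X s @^-1` A.
  rewrite (_ : (fun w => _) = (fun w => f (X (s + n)%N w)) \_ F).
    rewrite -Rintegral_mkcond; apply: event_decay.
    exact: natural_filtration_preimage.
  apply/funext => w; rewrite patchE /F indicE.
  rewrite (_ : (w \in X s @^-1` A) = (X s w \in A)); last first.
    by apply/idP/idP; rewrite !inE.
  by case: ifP; rewrite ?mul1r ?mul0r.
pose g (x : borel S) := (2 * M)^-1 * f x + 2^-1.
have bg : bounded_measurable g.
  by apply: bounded_measurable_affine => //; exact: bounded_measurable_cst.
have g01 x : 0 <= g x <= 1.
  have M20 : 0 < 2 * M by rewrite mulr_gt0.
  have : `|(2 * M)^-1 * f x| <= 2^-1.
    have M20' : 0 <= (2 * M)^-1 by rewrite invr_ge0 ltW.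
    rewrite normrM (ger0_norm M20') [leLHS]mulrC ler_pdivrMr//.
    by have := fM x; lra.
  by rewrite ler_norml /g => /andP[? ?]; apply/andP; split; lra.
have Phig : `|Phi g| <= K * q ^+ n.
  apply: (functional_superlevel_le Phi_affine Phi_bounded) => //.
    exact: bg.1.
  by move=> r; apply: Phi_indic; apply: measurable_superlevel; exact: bg.1.
have Phi1 : `|Phi (fun=> 1)| <= K * q ^+ n.
  have := Phi_indic _ measurableT.
  by rewrite (_ : \1_setT = fun=> 1)//; apply/funext => x; rewrite indicT.
have b1 := bounded_measurable_cst (borel S) (1 : R).
have b0 := bounded_measurable_cst (borel S) (0 : R).
have fE : f = fun x => 2 * M * g x + (- M * 1 + 0).
  by apply/funext => x; rewrite /g; field; rewrite gt_eqF.
have Phi0 : Phi (fun=> 0) = 0.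
  apply/normr0_eq0/le_anti; rewrite normr_ge0 andbT -[leRHS](mulr0 M).
  by apply: Phi_bounded => // x; rewrite normr0.
have PhifE : Phi f = 2 * M * Phi g - M * Phi (fun=> 1).
  rewrite {1}fE Phi_affine//; last exact: bounded_measurable_affine.
  by rewrite (Phi_affine (- M) _ _ b1 b0) Phi0 mulNr addr0.
have : `|Phi f| <= 2 * M * `|Phi g| + M * `|Phi (fun=> 1)|.
  rewrite PhifE (le_trans (ler_normB _ _))// !normrM.
  by rewrite (gtr0_norm M0) (@gtr0_norm _ 2).
rewrite -/(Phi f) => /le_trans; apply.
have M20 : 0 <= 2 * M by rewrite mulr_ge0// ltW.
have := ler_wpM2l M20 Phig; have := ler_wpM2l (ltW M0) Phi1.
set c := K * q ^+ n; set u := `|Phi g|; set v := `|Phi (fun=> 1)|; lra.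
Qed.

Let Y t w := f (X t w).
Let c0 := 3 * M * K.

Let c00 : 0 <= c0. Proof. by rewrite /c0 !mulr_ge0// ltW. Qed.

(** The geometric bound is chosen so that it is exactly reproduced by the
    recursion: [q ^+ m.+2 / (1 - q) + q ^+ m.+1 = q ^+ m.+1 / (1 - q)]. *)
Lemma psum_correlation j m :
  `|\int[Pr]_w (psum Y j w * Y (j + m)%N w)| <= c0 * q ^+ m.+1 / (1 - q).
Proof.
have /andP[q0 q1] := q01; have q1' : 0 < 1 - q by lra.
elim: j m => [|j IH] m.
  rewrite (_ : (fun _ => _) = cst 0).
    rewrite Rintegral_cst// mul0r normr0 divr_ge0 ?(ltW q1')//.
    by rewrite mulr_ge0// exprn_ge0.
  by apply/funext => w; rewrite /psum big_geq// mul0r.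
have bYj : bounded_measurable (fun w => psum Y j w * Y (j + m.+1)%N w).
  exact: (bounded_measurableM (bounded_measurable_psum bfX j) (bfX _)).
have bY2 : bounded_measurable (fun w => Y j w * Y (j + m.+1)%N w).
  exact: (bounded_measurableM (bfX _) (bfX _)).
rewrite (_ : (fun _ => _) =
    fun w => 1 * (psum Y j w * Y (j + m.+1)%N w) + Y j w * Y (j + m.+1)%N w).
  rewrite (Rintegral_affine Pr1)// mul1r (le_trans (ler_normD _ _))//.
  have := correlation_decay j m.+1; have := IH m.+1; rewrite mulrA -/c0.
  move=> le1 le2; apply: (le_trans (lerD le1 le2)).
  rewrite le_eqVlt; apply/orP; left; apply/eqP.
  by rewrite /c0 [q ^+ m.+2]exprS; field; rewrite gt_eqF.
by apply/funext => w; rewrite /psum big_nat_recr//= addSnnS; ring.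
Qed.

Lemma psum_second_moment n :
  \int[Pr]_w (psum Y n w ^+ 2) <= (M ^+ 2 + 2 * (c0 * q / (1 - q))) * n%:R.
Proof.
elim: n => [|n IH].
  rewrite mulr0 (_ : (fun _ => _) = cst 0) ?Rintegral_cst ?mul0r//.
  by apply/funext => w; rewrite /psum big_geq// expr0n.
have bp := bounded_measurable_psum bfX n.
have bpY : bounded_measurable (fun w => psum Y n w * Y n w).
  exact: (bounded_measurableM bp (bfX n)).
have bpp : bounded_measurable (fun w => psum Y n w ^+ 2).
  rewrite (_ : (fun _ => _) = psum Y n \* psum Y n); first exact: bounded_measurableM.
  by apply/funext => w; rewrite expr2.
have bYY : bounded_measurable (fun w => Y n w ^+ 2).
  rewrite (_ : (fun _ => _) = Y n \* Y n); last by apply/funext => w; rewrite expr2.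
  exact: (bounded_measurableM (bfX n) (bfX n)).
rewrite (_ : (fun _ => _) = fun w => 1 * psum Y n w ^+ 2 +
    (2 * (psum Y n w * Y n w) + Y n w ^+ 2)); last first.
  by apply/funext => w; rewrite /psum big_nat_recr//=; ring.
rewrite (Rintegral_affine Pr1)//; last exact: bounded_measurable_affine.
rewrite (Rintegral_affine Pr1)// mul1r -[n.+1%:R]natr1 [leRHS]mulrDr mulr1 lerD// addrC lerD//.
  have YM w : `|Y n w ^+ 2| <= M ^+ 2 by rewrite normrX lerXn2r ?nnegrE ?(ltW M0)//; exact: fM.
  exact: le_trans (ler_norm _) (norm_Rintegral_le1 Pr1 measurableT bYY YM).
rewrite ler_wpM2l//; have := psum_correlation n 0; rewrite addn0 expr1.
by apply: le_trans; exact: ler_norm.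
Qed.

Theorem markov_average_cvg0 : {ae Pr, forall w,
  n%:R^-1 * \sum_(0 <= t < n) f (X t w) @[n --> \oo] --> 0}.
Proof.
apply: (@average_cvg0_ae _ _ _ Pr Y M _ bfX) => //; last exact: psum_second_moment.
by move=> t w; exact: fM.
Qed.

End decorrelation.
End markov_chain.

(** * Monotone ergodicity *)

Section ergodicity.
Context d (S : POrderedPointedTopological.type d) (R : realType) (a b : S).
Hypothesis a_min : forall x : S, (a <= x)%O.
Hypothesis b_max : forall x : S, (x <= b)%O.
Hypothesis order_near : forall x y : S, ~ (x <= y)%O ->
  \forall x' \near x & y' \near y, ~ (x' <= y')%O.
Variables (P : R -> R.-pker (borel S) ~> (borel S)) (u eps : R).
Hypothesis tP : transition_function nonneg_integers P.
Hypothesis iP : increasing_transition nonneg_integers P.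
Hypotheses (Tu : nonneg_integers u) (u0 : 0 < u).
Hypothesis mixP : monotone_mixing a b (P u) eps.

Let TimeE : @nonneg_integers R = nonneg_reals \/ @nonneg_integers R = nonneg_integers.
Proof. by right. Qed.

Let Tn n : @nonneg_integers R n%:R. Proof. by exists n. Qed.

Lemma kiter_transition n (h : S -> R) : ib h -> kiter (P 1) n h = kint (P n%:R) h.
Proof.
elim: n h => [|n IH] h ibh /=; first by rewrite (kint_transition0 tP).
rewrite IH; last exact: (ib_transition iP (Tn 1)).
by rewrite -(kint_transitionD tP (Tn n) (Tn 1))// natr1.
Qed.

(** [kint (P n) h] ranges over an interval that contains its stationary mean,
    which is that of [h], namely 0. *)
Lemma centered_decay phistar (h : S -> R) n x :
  stationary nonneg_integers P phistar -> ib h -> \int[phistar]_x h x = 0 ->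
  `|kint (P n%:R) h x| <= kint (P n%:R) h b - kint (P n%:R) h a.
Proof.
move=> sphi ibh h0; have ibg := ib_transition iP (Tn n) ibh.
have /andP[? ?] := ib_range a_min b_max x ibg.
have := Rintegral_ib_range a_min b_max (probability_setT phistar) ibg.
rewrite -kint_act// (stationary_Rintegral (Tn n) ibh sphi) h0 => /andP[? ?].
by rewrite ler_norml; apply/andP; split; lra.
Qed.

Theorem markov_monotone_ergodic phistar dO (Omega : measurableType dO)
    (Pr : probability Omega R) (X : nat -> {RV Pr >-> borel S}) :
  stationary nonneg_integers P phistar -> markov_process (P 1) X ->
  monotone_ergodic phistar X.
Proof.
move=> sphi mX h ibh; have bh := ib_bounded_measurable ibh.
have bhX t := bounded_measurable_RV X t bh.
have bsum n := bounded_measurable_psum bhX n.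
apply: ae_probability1.
  apply: measurable_cvg_set => n; apply: measurable_funM => //.
  exact: (bsum n).1.
pose c := \int[phistar]_x h x; pose f x := 1 * h x + (- c).
have ibf : ib f by exact: ib_affine.
have f0 : \int[phistar]_x f x = 0.
  have phi1 : (phistar [set: borel S] <= 1)%E.
    by rewrite [X in (X <= _)%E](_ : _ = 1%E)//; exact: probability_setT.
  rewrite /f (Rintegral_affine phi1)//; last exact: bounded_measurable_cst.
  rewrite mul1r -/c Rintegral_cst// [X in fine X](_ : _ = 1%E) ?mulr1 ?subrr//.
  exact: probability_setT.
have [_ [M fM] incf] := ibf.
(* For [eps = 1] the rate [ln (1 / (1 - eps))] degenerates, so the decay is
   taken from the weaker mixing constant [e < 1]. *)
pose e := Num.min eps (1 / 2).
have [eps0 _] := mixP.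
have e0 : 0 < e by rewrite lt_min eps0; lra.
have e1 : e < 1 by rewrite gt_min; apply/orP; right; lra.
have mixe : monotone_mixing a b (P u) e by apply: mixing_le mixP => //; rewrite ge_min lexx.
pose q := expR (- (ln (1 / (1 - e)) / u)); pose K := (1 - e)^-1 * (f b - f a).
have K0 : 0 <= K by rewrite mulr_ge0 ?invr_ge0 ?subr_ge0 ?(ltW e1)// incf.
have q01 : 0 <= q < 1.
  rewrite expR_ge0/= expR_lt1 oppr_lt0 divr_gt0// ln_gt0//.
  by rewrite ltr_pdivlMr ?subr_gt0// mul1r; lra.
have decay n x : `|kiter (P 1) n f x| <= K * q ^+ n.
  rewrite kiter_transition//; apply: (le_trans (centered_decay n x sphi ibf f0)).
  apply: (le_trans (osc_exponential a_min b_max order_near TimeE tP iP Tu u0 mixe e1 (Tn n) ibf)).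
  by rewrite /q -expRM_natl [n%:R * _]mulrC /K mulrAC.
have fM1 x : `|f x| <= `|M| + 1.
  by rewrite (le_trans (fM x))// (le_trans (ler_norm _))// lerDl.
have M1 : 0 < `|M| + 1 by rewrite ltr_wpDl.
have := markov_average_cvg0 mX (ib_bounded_measurable ibf) M1 fM1 K0 q01 decay.
apply: filterS => w cw; apply/cvgrPdist_lt => r r0.
have [N _ Nw] := (cvgr0Pnorm_lt _).1 cw _ r0.
exists N.+1 => // n /= Nn; have n0 : n%:R != 0 :> R.
  by rewrite pnatr_eq0 -lt0n (leq_ltn_trans _ Nn).
have := Nw n (ltnW Nn) => /=; rewrite -normrN; congr (`|_| < _).
rewrite /f big_split/= sumr_const_nat subn0 -mulr_natr -mulr_sumr mul1r -/c.
by field.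
Qed.

End ergodicity.

Theorem theorem5p1 (R : realType) (d : Order.disp_t)
    (S : POrderedPointedTopological.type d) (a b : S) (Time : set R)
    (P : R -> R.-pker (borel S) ~> (borel S)) (u eps : R) :
  compact [set: S] ->
  partially_ordered_polish R S ->
  (forall x : S, (a <= x)%O) ->
  (forall x : S, (x <= b)%O) ->
  Time = nonneg_reals \/ Time = nonneg_integers ->
  transition_function Time P ->
  increasing_transition Time P ->
  Time u -> 0 < u ->
  monotone_mixing a b (P u) eps ->
  globally_stable Time P /\
  (forall phistar : probability (borel S) R, stationary Time P phistar ->
    (eps < 1 ->
      let C := 2 / (1 - eps) in
      let alpha := ln (1 / (1 - eps)) / u in
      forall (phi : probability (borel S) R) (t : R), Time t ->
        bhattacharya (act phi (P t)) phistar <= C * expR (- alpha * t)) /\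
    (Time = nonneg_integers ->
      forall (dO : measure_display) (Omega : measurableType dO)
        (Pr : probability Omega R) (X : nat -> {RV Pr >-> borel S}),
        markov_process (P 1) X -> monotone_ergodic phistar X)).
Proof.
move=> cS [sepS metS ordS] a_min b_max TimeE tP iP Tu u0 mixP.
have order_near := closed_order_near metS ordS.
have [B basisB] := polish_closed_basis sepS metS.
split.
  exact: (mixing_globally_stable a_min b_max order_near TimeE tP iP Tu u0 mixP cS basisB).
move=> phistar sphi; split=> [eps1 C alpha phi t Tt|TimeZ dO Omega Pr X mX].
  exact: (bhattacharya_exponential a_min b_max order_near TimeE tP iP Tu u0 mixP).
move: tP iP Tu sphi; rewrite TimeZ => tP' iP' Tu' sphi.
exact: (markov_monotone_ergodic a_min b_max order_near tP' iP' Tu' u0 mixP).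
Qed.
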